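(* Let $p,q\in[1,\infty)$ with $p\ne q$. Then $(\oplus T^p)_{T^q}$ does not coarse Lipschitz embed into $T^p\oplus T^q$.
   Context: $T$ is the Tsirelson space: completion of $c_{00}$ under the unique norm with $\|x\|=\max\{\max_n|x_n|,\frac12\sup\sum_{j=1}^k\|E_jx\|\}$, sup over $k$ and finite sets $k\le\min E_1$, $\max E_j<\min E_{j+1}$, $Ex$ the restriction of $x$ to $E$. For $r\ge1$, $T^r$ is its $r$-convexification: real sequences $(x_n)$ with $\sum|x_n|^re_n\in T$, $\|x\|_r=\|\sum|x_n|^re_n\|_T^{1/r}$. $(\oplus T^p)_{T^q}$ is the space of sequences $(x_n)$ in $T^p$ with $\|(x_n)\|=\|\sum_n\|x_n\|e_n\|_{T^q}<\infty$, $(e_n)$ the unit vector basis of $T^q$. A coarse Lipschitz embedding is a map $f$ with $\omega_f(t)\le Lt+L$ and $\rho_f(t)\ge L^{-1}t-L$ for some $L>0$, where $\omega_f(t)=\sup\{\|f(x)-f(y)\|:\|x-y\|\le t\}$, $\rho_f(t)=\inf\{\|f(x)-f(y)\|:\|x-y\|\ge t\}$. *)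

(* Defs.v *)
From Stdlib Require Import Reals List Arith ClassicalEpsilon.
Import ListNotations.
Open Scope R_scope.

(* Real sequences.  CONVENTION: Coq index n corresponds to the paper's
   index n+1 (the paper's unit vectors are e_1, e_2, ...). *)
Definition rseq := nat -> R.

Definition finsupp (x : rseq) : Prop :=
  exists N : nat, forall n : nat, (N <= n)%nat -> x n = 0.

Definition restrict (E : list nat) (x : rseq) : rseq :=
  fun n => if in_dec Nat.eq_dec n E then x n else 0.

(* admissible families E_1 < ... < E_k of finite sets with k <= min E_1
   (paper indices; in Coq indices this reads k <= a + 1 for a in E_1) *)
Definition admissible (Es : list (list nat)) : Prop :=
  Es <> nil /\
  Forall (fun E => E <> nil) Es /\
  (forall a : nat, In a (hd nil Es) -> (length Es <= S a)%nat) /\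
  (forall (j a b : nat), (S j < length Es)%nat ->
     In a (nth j Es nil) -> In b (nth (S j) Es nil) -> (a < b)%nat).

Definition sum_restr (f : rseq -> R) (Es : list (list nat)) (x : rseq) : R :=
  fold_right (fun E acc => f (restrict E x) + acc) 0 Es.

Definition TsirelsonEq (f : rseq -> R) : Prop :=
  forall x : rseq, finsupp x ->
    exists a b : R,
      is_lub (fun r => exists n : nat, r = Rabs (x n)) a /\
      is_lub (fun r => exists Es, admissible Es /\ r = sum_restr f Es x) b /\
      f x = Rmax a (b / 2).

(* "the unique norm" satisfying the equation on c00 *)
Definition Tnorm00 : rseq -> R :=
  epsilon (inhabits (fun _ : rseq => 0)) TsirelsonEq.

Definition proj (n : nat) (x : rseq) : rseq :=
  fun i => if lt_dec i n then x i else 0.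

Definition rsub (x y : rseq) : rseq := fun i => x i - y i.

(* T = completion of c00, realised as the sequences whose partial sums
   (proj n x) are Cauchy for the Tsirelson norm; the norm is the limit. *)
Definition inT (x : rseq) : Prop :=
  forall eps : R, 0 < eps -> exists N : nat, forall m n : nat,
    (N <= m)%nat -> (N <= n)%nat -> Tnorm00 (rsub (proj m x) (proj n x)) < eps.

Definition Tnorm (x : rseq) : R :=
  epsilon (inhabits 0) (fun l => Un_cv (fun n => Tnorm00 (proj n x)) l).

(* a^r for a >= 0, r >= 1, with 0^r = 0 *)
Definition rpow (a r : R) : R := if Rle_dec a 0 then 0 else Rpower a r.

Definition inTr (r : R) (x : rseq) : Prop := inT (fun n => rpow (Rabs (x n)) r).

Definition Trnorm (r : R) (x : rseq) : R :=
  rpow (Tnorm (fun n => rpow (Rabs (x n)) r)) (1 / r).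

Definition inSumTpTq (p q : R) (x : nat -> rseq) : Prop :=
  (forall n, inTr p (x n)) /\ inTr q (fun n => Trnorm p (x n)).

Definition SumTpTq_norm (p q : R) (x : nat -> rseq) : R :=
  Trnorm q (fun n => Trnorm p (x n)).

Definition SumTpTq_dist (p q : R) (x y : nat -> rseq) : R :=
  SumTpTq_norm p q (fun n => rsub (x n) (y n)).

Definition inTpTq (p q : R) (z : rseq * rseq) : Prop :=
  inTr p (fst z) /\ inTr q (snd z).

Definition TpTq_dist (p q : R) (z w : rseq * rseq) : R :=
  Trnorm p (rsub (fst z) (fst w)) + Trnorm q (rsub (snd z) (snd w)).

(* coarse Lipschitz embedding between subsets of metric-like spaces;
   omega_f(t) <= L t + L and rho_f(t) >= t/L - L written out for t >= 0 *)
Definition coarse_lipschitz_embedding {X Y : Type}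
  (inX : X -> Prop) (dX : X -> X -> R) (inY : Y -> Prop) (dY : Y -> Y -> R)
  (f : X -> Y) : Prop :=
  (forall x, inX x -> inY (f x)) /\
  exists L : R, 0 < L /\
    (forall t : R, 0 <= t -> forall x y, inX x -> inX y ->
        dX x y <= t -> dY (f x) (f y) <= L * t + L) /\
    (forall t : R, 0 <= t -> forall x y, inX x -> inX y ->
        t <= dX x y -> t / L - L <= dY (f x) (f y)).

(* Main.v *)
(** Let [s < l] be the two exponents, and write an embedding [f] as [(g, h)] with
    [g] valued in [T^s] and [h] in [T^l].

    [T^l] satisfies an upper [l]-estimate on disjoint vectors and its basis is
    boundedly complete.  Hence a map from k-tuples of integers to [T^l] that moves by
    at most [lam] when one entry changes is, after iterated limits along an ultrafilter,
    within [k^(1/l) lam] of a constant (Kalton-Randrianarivony).  On the other hand [T]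
    dominates weak [l_1] on successive blocks, so for [s < r < l] the space [T^s] has an
    equivalent norm with a lower [r]-estimate of constant one, and approximate midpoints
    for that norm are compact up to a small ball: if [x] and [y] almost attain the
    Lipschitz constant of [g] at large scale, [g] sends the midpoints of [x] and [y]
    perturbed by [delta] to a compact set fattened by [delta^(l/r)], which is much
    smaller than [delta].

    It remains to find, around the midpoint of any two points of the domain,
    perturbations of size [delta] in an outer or inner [T^l] direction that are indexed
    by k-tuples and are spread out like k terms of [l_s].  On these neither [g] nor [h]
    can separate points. *)

From mathcomp Require filter.
Require Import Defs.
From Stdlib Require Import Reals Lra Lia List Arith.
From Stdlib Require Import Classical ClassicalEpsilon FunctionalExtensionality.
From Stdlib Require FinFun.
Import ListNotations.
Open Scope R_scope.

(** * Real powers *)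

(** The exponent [r] is squeezed from both sides: [r > s] because weak l_1 gives l_rho sums only for
    rho > 1, and [r < l] because a perturbation of relative size sigma lengthens the two
    half-distances by a factor 1 + O(sigma^l), which must be negligible against sigma^r. The lower
    estimate needs constant one: the tail of a midpoint is bounded by a difference of two nearly
    equal r-th powers, which a multiplicative constant would swamp. The parameters are fixed in the
    order k, theta, sigma, eps, t. Since sigma comes after k, the optimal slope of [g] may depend on
    k. This is what permits, for p > q, an auxiliary metric comparable to the norm only up to the
    factor k^(1/s). Norms of infinite sequences enter only as upper bounds for all partial sums, so
    coordinatewise limits need not be shown to lie in T. In the domain only finitely supported
    vectors are used. *)

Lemma rpow_nonpos (a r : R) : a <= 0 -> rpow a r = 0.
Proof. intros H; unfold rpow; destruct (Rle_dec a 0); [easy|lra]. Qed.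

Lemma rpow_pos_eq (a r : R) : 0 < a -> rpow a r = Rpower a r.
Proof. intros H; unfold rpow; destruct (Rle_dec a 0); [lra|easy]. Qed.

Lemma rpow_0 (r : R) : rpow 0 r = 0.
Proof. apply rpow_nonpos; lra. Qed.

Lemma rpow_gt0 (a r : R) : 0 < a -> 0 < rpow a r.
Proof. intros H; rewrite rpow_pos_eq by easy; apply exp_pos. Qed.

Lemma rpow_ge0 (a r : R) : 0 <= rpow a r.
Proof.
destruct (Rle_dec a 0) as [H|H].
- rewrite rpow_nonpos by easy; lra.
- apply Rlt_le, rpow_gt0; lra.
Qed.

Lemma rpow_1_l (r : R) : rpow 1 r = 1.
Proof.
rewrite rpow_pos_eq by lra; unfold Rpower; rewrite ln_1, Rmult_0_r; apply exp_0.
Qed.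

Lemma rpow_1_r (a : R) : 0 <= a -> rpow a 1 = a.
Proof.
intros [H| <-]; [|apply rpow_0].
rewrite rpow_pos_eq by easy; now apply Rpower_1.
Qed.

Lemma rpow_le (a b r : R) : 0 <= r -> a <= b -> rpow a r <= rpow b r.
Proof.
intros Hr Hab; destruct (Rle_dec a 0) as [H|H].
- rewrite rpow_nonpos by easy; apply rpow_ge0.
- rewrite !rpow_pos_eq by lra; apply Rle_Rpower_l; lra.
Qed.

Lemma rpow_lt (a b r : R) : 0 < r -> 0 <= a -> a < b -> rpow a r < rpow b r.
Proof.
intros Hr [Ha| <-] Hab.
- rewrite !rpow_pos_eq by lra; apply Rlt_Rpower_l; lra.
- rewrite rpow_0; apply rpow_gt0; lra.
Qed.

Lemma rpow_le_inv (a b r : R) : 0 < r -> 0 <= b -> rpow a r <= rpow b r -> a <= b.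
Proof.
intros Hr Hb H; destruct (Rle_dec a b) as [|Hn]; [easy|].
assert (rpow b r < rpow a r) by (apply rpow_lt; lra); lra.
Qed.

Lemma rpow_mult (a b r : R) :
  0 <= a -> 0 <= b -> rpow (a * b) r = rpow a r * rpow b r.
Proof.
intros [Ha| <-] [Hb| <-]; rewrite ?Rmult_0_l, ?Rmult_0_r, ?rpow_0; try lra.
rewrite !rpow_pos_eq by (try apply Rmult_lt_0_compat; lra).
now rewrite Rpower_mult_distr.
Qed.

Lemma rpow_rpow (a r s : R) : rpow (rpow a r) s = rpow a (r * s).
Proof.
destruct (Rle_dec a 0) as [H|H].
- now rewrite !(rpow_nonpos a), rpow_0 by easy.
- rewrite (rpow_pos_eq (rpow a r)) by (apply rpow_gt0; lra).
  rewrite !(rpow_pos_eq a) by lra; apply Rpower_mult.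
Qed.

Lemma rpow_inv_rpow (a r : R) : 0 < r -> 0 <= a -> rpow (rpow a (1 / r)) r = a.
Proof.
intros Hr Ha; rewrite rpow_rpow; replace (1 / r * r) with 1 by (field; lra).
now apply rpow_1_r.
Qed.

Lemma rpow_inv_le (a b r : R) :
  0 < r -> 0 <= b -> a <= rpow b r -> rpow a (1 / r) <= b.
Proof.
intros Hr Hb H; apply (rpow_le_inv _ _ r); try easy.
destruct (Rle_dec a 0) as [Ha|Ha].
- rewrite (rpow_nonpos a), rpow_0 by easy; apply rpow_ge0.
- rewrite rpow_inv_rpow; lra.
Qed.

Lemma rpow_le_of_inv (a b r : R) :
  0 < r -> 0 <= a -> rpow a (1 / r) <= b -> a <= rpow b r.
Proof.
intros Hr Ha H; rewrite <- (rpow_inv_rpow a r) by easy; apply rpow_le; lra.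
Qed.

Lemma rpow_Ropp_r (a r : R) : 0 < a -> rpow a (- r) = / rpow a r.
Proof. intros Ha; rewrite !rpow_pos_eq by easy; apply Rpower_Ropp. Qed.

Lemma rpow_plus_r (a r s : R) : rpow a (r + s) = rpow a r * rpow a s.
Proof.
destruct (Rle_dec a 0) as [H|H].
- rewrite !rpow_nonpos by easy; lra.
- rewrite !rpow_pos_eq by lra; apply Rpower_plus.
Qed.

Lemma rpow_ge1 (a r : R) : 0 <= r -> 1 <= a -> 1 <= rpow a r.
Proof. intros Hr Ha; rewrite <- (rpow_1_l r); now apply rpow_le. Qed.

Lemma rpow_le_exponent (a r s : R) : 1 <= a -> r <= s -> rpow a r <= rpow a s.
Proof. intros Ha Hr; rewrite !rpow_pos_eq by lra; now apply Rle_Rpower. Qed.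

Lemma exp_tangent (z z0 : R) : exp z0 * (1 + (z - z0)) <= exp z.
Proof.
replace (exp z) with (exp z0 * exp (z - z0)) by (rewrite <- exp_plus; f_equal; ring).
apply Rmult_le_compat_l; [apply Rlt_le, exp_pos|].
destruct (Req_dec (z - z0) 0) as [->|H]; [rewrite exp_0; lra|].
apply Rlt_le, exp_ineq1; easy.
Qed.

(** After an r-th root this is the weighted AM-GM inequality for [b] and 1 with weights 1/r and 1 -
    1/r. It follows from the tangent to exp at the weighted mean of ln b and 0. *)
Lemma rpow_bernoulli (y r : R) : 1 <= r -> 0 <= y -> 1 + r * (y - 1) <= rpow y r.
Proof.
intros Hr Hy; destruct (Rle_dec (1 + r * (y - 1)) 0) as [H|H].
{ pose proof (rpow_ge0 y r); lra. }
set (b := 1 + r * (y - 1)) in *.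
apply rpow_le_of_inv; [lra|lra|].
assert (Ht : 0 < 1 / r <= 1).
{ split; [apply Rdiv_lt_0_compat; lra|].
  unfold Rdiv; rewrite Rmult_1_l, <- Rinv_1; apply Rinv_le_contravar; lra. }
replace y with (1 / r * b + (1 - 1 / r)) by (unfold b; field; lra).
set (t := 1 / r) in *.
rewrite rpow_pos_eq by lra; unfold Rpower.
pose proof (exp_tangent (ln b) (t * ln b)) as H1.
pose proof (exp_tangent 0 (t * ln b)) as H2.
rewrite exp_ln in H1 by lra; rewrite exp_0 in H2.
set (e := exp (t * ln b)) in *.
assert (t * (e * (1 + (ln b - t * ln b))) <= t * b) by (apply Rmult_le_compat_l; lra).
assert ((1 - t) * (e * (1 + (0 - t * ln b))) <= (1 - t) * 1)
  by (apply Rmult_le_compat_l; lra).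
nra.
Qed.

Lemma rpow_convex (u v lam r : R) :
  1 <= r -> 0 <= u -> 0 <= v -> 0 <= lam <= 1 ->
  rpow (lam * u + (1 - lam) * v) r <= lam * rpow u r + (1 - lam) * rpow v r.
Proof.
intros Hr Hu Hv Hl; set (m := lam * u + (1 - lam) * v).
destruct (Rle_dec m 0) as [H|H].
{ rewrite rpow_nonpos by easy.
  pose proof (rpow_ge0 u r); pose proof (rpow_ge0 v r); nra. }
(* The supporting line of w^r at the mean [m]: Bernoulli rescaled by homogeneity. Its weighted
   average over [u] and [v] is exactly m^r. *)
assert (Hg : forall w, 0 <= w -> rpow m r * (1 + r * (w / m - 1)) <= rpow w r).
{ intros w Hw; replace (rpow w r) with (rpow m r * rpow (w / m) r).
  - apply Rmult_le_compat_l; [apply rpow_ge0|].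
    apply rpow_bernoulli; [easy|apply Rle_mult_inv_pos; lra].
  - rewrite <- rpow_mult; [f_equal; field; lra|lra|apply Rle_mult_inv_pos; lra]. }
pose proof (Hg u Hu) as H1; pose proof (Hg v Hv) as H2.
apply (Rmult_le_compat_l lam) in H1; [|lra].
apply (Rmult_le_compat_l (1 - lam)) in H2; [|lra].
apply Rle_trans with (2 := Rplus_le_compat _ _ _ _ H1 H2).
apply Req_le.
replace (lam * (rpow m r * (1 + r * (u / m - 1))) +
  (1 - lam) * (rpow m r * (1 + r * (v / m - 1))))
  with (rpow m r * (1 + r * ((lam * u + (1 - lam) * v) / m - 1))) by (field; lra).
fold m; field; lra.
Qed.

(* Minkowski's inequality is obtained by summing this linear bound, whose
   coefficients do not depend on [u] and [v]. *)
Lemma rpow_add_linear (alpha beta r : R) :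
  1 <= r -> 0 < alpha -> 0 < beta ->
  exists P Q : R, 0 <= P /\ 0 <= Q /\
    (forall u v, 0 <= u -> 0 <= v ->
      rpow (u + v) r <= P * rpow u r + Q * rpow v r) /\
    P * rpow alpha r + Q * rpow beta r = rpow (alpha + beta) r.
Proof.
intros Hr Ha Hb; set (s := alpha + beta).
assert (Hs : 0 < s) by (unfold s; lra).
assert (Hra := rpow_gt0 alpha r Ha); assert (Hrb := rpow_gt0 beta r Hb).
assert (Hrs := rpow_gt0 s r Hs).
assert (Hc : forall c, 0 < c -> forall w, 0 <= w ->
   rpow (s / c * w) r = rpow s r / rpow c r * rpow w r).
{ intros c Hc w Hw.
  assert (Hcr := rpow_gt0 c r Hc).
  assert (0 <= w / c) by (apply Rle_mult_inv_pos; lra).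
  replace (rpow w r) with (rpow c r * rpow (w / c) r)
    by (rewrite <- rpow_mult by lra; f_equal; field; lra).
  replace (s / c * w) with (s * (w / c)) by (field; lra).
  rewrite rpow_mult by lra; field; lra. }
(* These are (s/alpha)^(r-1) and (s/beta)^(r-1); the bound is convexity applied to u + v =
   (alpha/s)(s u/alpha) + (beta/s)(s v/beta). *)
exists (alpha / s * (rpow s r / rpow alpha r)), (beta / s * (rpow s r / rpow beta r)).
assert (0 < alpha / s) by (apply Rdiv_lt_0_compat; lra).
assert (0 < beta / s) by (apply Rdiv_lt_0_compat; lra).
assert (0 < rpow s r / rpow alpha r) by (apply Rdiv_lt_0_compat; lra).
assert (0 < rpow s r / rpow beta r) by (apply Rdiv_lt_0_compat; lra).
split; [nra|]; split; [nra|]; split.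
- intros u v Hu Hv.
  rewrite !Rmult_assoc, <- !Hc by lra.
  assert (E : 1 - alpha / s = beta / s) by (unfold s; field; unfold s in *; lra).
  assert (0 < s / alpha) by (apply Rdiv_lt_0_compat; lra).
  assert (0 < s / beta) by (apply Rdiv_lt_0_compat; lra).
  rewrite <- E; eapply Rle_trans; [|apply rpow_convex; try nra].
  rewrite E; apply Req_le; f_equal; field; lra.
- unfold s at 1 3; field_simplify; [|unfold s in *; lra..].
  replace (alpha * rpow s r + beta * rpow s r) with (s * rpow s r) by (unfold s; ring).
  fold s; field; lra.
Qed.

(** * The Tsirelson norm *)

Definition lsum {A : Type} (f : A -> R) (l : list A) : R :=
  fold_right (fun a acc => f a + acc) 0 l.

Lemma lsum_app {A : Type} (f : A -> R) (l1 l2 : list A) :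
  lsum f (l1 ++ l2) = lsum f l1 + lsum f l2.
Proof. induction l1 as [|a l1 IH]; simpl; [lra|rewrite IH; lra]. Qed.

Lemma lsum_le {A : Type} (f g : A -> R) (l : list A) :
  (forall a, In a l -> f a <= g a) -> lsum f l <= lsum g l.
Proof.
induction l as [|a l IH]; simpl; intros H; [lra|].
apply Rplus_le_compat; auto.
Qed.

Lemma lsum_ext {A : Type} (f g : A -> R) (l : list A) :
  (forall a, In a l -> f a = g a) -> lsum f l = lsum g l.
Proof. intros H; apply Rle_antisym; apply lsum_le; intros; rewrite H; auto; lra. Qed.

Lemma lsum_const {A : Type} (c : R) (l : list A) :
  lsum (fun _ => c) l = INR (length l) * c.
Proof.
induction l as [|a l IH]; [simpl; lra|].
simpl length; rewrite S_INR; simpl; rewrite IH; lra.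
Qed.

Lemma lsum_nonneg {A : Type} (f : A -> R) (l : list A) :
  (forall a, In a l -> 0 <= f a) -> 0 <= lsum f l.
Proof.
intros H; apply Rle_trans with (lsum (fun _ : A => 0) l).
- rewrite lsum_const; lra.
- now apply lsum_le.
Qed.

Lemma lsum_plus {A : Type} (f g : A -> R) (l : list A) :
  lsum (fun a => f a + g a) l = lsum f l + lsum g l.
Proof. induction l as [|a l IH]; simpl; [lra|rewrite IH; lra]. Qed.

Lemma lsum_scal {A : Type} (c : R) (f : A -> R) (l : list A) :
  lsum (fun a => c * f a) l = c * lsum f l.
Proof. induction l as [|a l IH]; simpl; [lra|rewrite IH; lra]. Qed.

Lemma lsum_map {A B : Type} (h : A -> B) (f : B -> R) (l : list A) :
  lsum f (map h l) = lsum (fun a => f (h a)) l.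
Proof. induction l as [|a l IH]; simpl; [easy|now rewrite IH]. Qed.

Lemma lsum_exchange {A B : Type} (f : A -> B -> R) (l : list A) (m : list B) :
  lsum (fun a => lsum (f a) m) l = lsum (fun b => lsum (fun a => f a b) l) m.
Proof.
induction l as [|a l IH]; simpl.
- rewrite lsum_const; lra.
- now rewrite IH, <- lsum_plus.
Qed.

Lemma restrict_in (E : list nat) (x : rseq) (n : nat) :
  In n E -> restrict E x n = x n.
Proof. intros H; unfold restrict; destruct (in_dec Nat.eq_dec n E); easy. Qed.

Lemma restrict_out (E : list nat) (x : rseq) (n : nat) :
  ~ In n E -> restrict E x n = 0.
Proof. intros H; unfold restrict; destruct (in_dec Nat.eq_dec n E); easy. Qed.

Lemma finsupp_restrict (E : list nat) (x : rseq) :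
  finsupp x -> finsupp (restrict E x).
Proof.
intros [N HN]; exists N; intros n Hn; unfold restrict.
destruct (in_dec Nat.eq_dec n E); auto.
Qed.

(** [admissible] compares only neighbours. Transitivity passes through an element of the set in
    between, so nonemptiness is essential. *)
Lemma admissible_pairwise (Es : list (list nat)) :
  admissible Es ->
  ForallOrdPairs (fun E F => forall a b, In a E -> In b F -> (a < b)%nat) Es.
Proof.
intros (_ & Hne & _ & Hc); revert Hne Hc.
induction Es as [|E Es IH]; intros Hne Hc; [constructor|].
assert (Hp : ForallOrdPairs (fun E F => forall a b, In a E -> In b F -> (a < b)%nat) Es).
{ apply IH; [now inversion Hne|].
  intros j a b Hj; apply (Hc (S j) a b); simpl; lia. }
constructor; [|easy].
destruct Es as [|F Es]; [constructor|].
assert (HEF : forall a b, In a E -> In b F -> (a < b)%nat)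
  by (intros a b; apply (Hc 0%nat a b); simpl; lia).
constructor; [easy|].
inversion Hp as [|? ? HF]; subst.
rewrite Forall_forall in HF |- *; intros G HG a b Ha Hb.
inversion Hne as [|? ? _ Hne']; inversion Hne' as [|? ? HneF _]; subst.
destruct F as [|c F]; [easy|].
apply Nat.lt_trans with c; [apply HEF; simpl; auto|apply (HF G HG); simpl; auto].
Qed.

Lemma admissible_sum_abs (Es : list (list nat)) (x : rseq) (n : nat) :
  admissible Es -> lsum (fun E => Rabs (restrict E x n)) Es <= Rabs (x n).
Proof.
intros H; apply admissible_pairwise in H.
induction H as [|E Es HE _ IH]; simpl; [apply Rabs_pos|].
destruct (in_dec Nat.eq_dec n E) as [Hin|Hin].
- rewrite restrict_in by easy.
  rewrite (lsum_ext _ (fun _ => 0)), lsum_const; [lra|].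
  intros F HF; rewrite restrict_out, Rabs_R0; [easy|].
  rewrite Forall_forall in HE; intros Hn; specialize (HE F HF n n Hin Hn); lia.
- rewrite restrict_out, Rabs_R0 by easy; lra.
Qed.

(* The Tsirelson norm is the infimum of the bounds [c] for which [Q x c] holds
   for some [Q] with the following closure property, so that upper bounds for it
   are proved by exhibiting such a [Q]. *)
Definition bound_closed (Q : rseq -> R -> Prop) : Prop :=
  forall x c, Q x c -> (forall n, Rabs (x n) <= c) /\
    forall Es, admissible Es -> exists gamma : list nat -> R,
      (forall E, In E Es -> Q (restrict E x) (gamma E)) /\ lsum gamma Es <= 2 * c.

Definition tsirelson_bound (x : rseq) (c : R) : Prop :=
  exists Q, bound_closed Q /\ Q x c.

Definition tsirelson_inf (x : rseq) : R :=
  epsilon (inhabits 0) (is_lub (fun m => forall c, tsirelson_bound x c -> m <= c)).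

Definition l1_bound (x : rseq) (c : R) : Prop :=
  exists N, (forall n, (N <= n)%nat -> x n = 0) /\
    lsum (fun n => Rabs (x n)) (seq 0 N) <= c.

(** Admissible sets are disjoint, so the l_1 norms of the pieces add up to at most [c]. This
    provides a [tsirelson_bound] for every finitely supported vector, so that the infimum exists. *)
Lemma l1_bound_closed : bound_closed l1_bound.
Proof.
intros x c (N & HN & Hc); split.
- intros n; destruct (le_lt_dec N n) as [H|H].
  + rewrite HN, Rabs_R0 by easy; apply Rle_trans with (2 := Hc).
    apply lsum_nonneg; intros; apply Rabs_pos.
  + apply Rle_trans with (2 := Hc).
    assert (Hi : In n (seq 0 N)) by (apply in_seq; lia).
    apply in_split in Hi; destruct Hi as (l1 & l2 & ->).
    rewrite lsum_app; simpl.
    assert (0 <= lsum (fun n => Rabs (x n)) l1) by (apply lsum_nonneg; intros; apply Rabs_pos).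
    assert (0 <= lsum (fun n => Rabs (x n)) l2) by (apply lsum_nonneg; intros; apply Rabs_pos).
    lra.
- intros Es HEs.
  exists (fun E => lsum (fun n => Rabs (restrict E x n)) (seq 0 N)); split.
  + intros E HE; exists N; split; [|lra].
    intros n Hn; unfold restrict; destruct (in_dec Nat.eq_dec n E); auto.
  + rewrite lsum_exchange.
    assert (0 <= c) by
      (apply Rle_trans with (2 := Hc); apply lsum_nonneg; intros; apply Rabs_pos).
    apply Rle_trans with c; [|lra].
    apply Rle_trans with (2 := Hc); apply lsum_le; intros n _.
    now apply admissible_sum_abs.
Qed.

Lemma tsirelson_inf_lub (x : rseq) :
  finsupp x ->
  is_lub (fun m => forall c, tsirelson_bound x c -> m <= c) (tsirelson_inf x).
Proof.
intros [N HN]; unfold tsirelson_inf; apply epsilon_spec.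
destruct (completeness (fun m => forall c, tsirelson_bound x c -> m <= c)) as [m Hm].
- exists (lsum (fun n => Rabs (x n)) (seq 0 N)); intros m Hm; apply Hm.
  exists l1_bound; split; [apply l1_bound_closed|exists N; split; [easy|lra]].
- exists 0; intros c (Q & HQ & Hx).
  apply Rle_trans with (Rabs (x 0%nat)); [apply Rabs_pos|now apply (HQ x c)].
- now exists m.
Qed.

Lemma tsirelson_inf_le (Q : rseq -> R -> Prop) (x : rseq) (c : R) :
  bound_closed Q -> finsupp x -> Q x c -> tsirelson_inf x <= c.
Proof.
intros HQ Hx Hc; apply (tsirelson_inf_lub x Hx).
intros m Hm; apply Hm; now exists Q.
Qed.

Lemma tsirelson_inf_abs (x : rseq) (n : nat) :
  finsupp x -> Rabs (x n) <= tsirelson_inf x.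
Proof.
intros Hx; apply (tsirelson_inf_lub x Hx).
intros c (Q & HQ & Hc); now apply (HQ x c).
Qed.

Lemma tsirelson_inf_admissible (x : rseq) (Es : list (list nat)) :
  finsupp x -> admissible Es ->
  lsum (fun E => tsirelson_inf (restrict E x)) Es <= 2 * tsirelson_inf x.
Proof.
intros Hx HEs.
enough (lsum (fun E => tsirelson_inf (restrict E x)) Es / 2 <= tsirelson_inf x) by lra.
apply (tsirelson_inf_lub x Hx); intros c (Q & HQ & Hc).
destruct (HQ x c Hc) as [_ H]; destruct (H Es HEs) as (gamma & Hg & Hs).
enough (lsum (fun E => tsirelson_inf (restrict E x)) Es <= lsum gamma Es) by lra.
apply lsum_le; intros E HE; apply (tsirelson_inf_le Q); auto using finsupp_restrict.
Qed.

Lemma admissible_singleton0 : admissible [[0%nat]].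
Proof.
repeat split; try easy.
- constructor; easy.
- intros a _; simpl; lia.
- intros j a b Hj; simpl in Hj; lia.
Qed.

Lemma tsirelson_inf_eq : TsirelsonEq tsirelson_inf.
Proof.
intros x Hx.
destruct (completeness (fun r => exists n : nat, r = Rabs (x n))) as [a Ha].
{ exists (tsirelson_inf x); intros r [n ->]; now apply tsirelson_inf_abs. }
{ now exists (Rabs (x 0%nat)), 0%nat. }
destruct (completeness (fun r => exists Es, admissible Es /\
  r = sum_restr tsirelson_inf Es x)) as [b Hb].
{ exists (2 * tsirelson_inf x); intros r (Es & HEs & ->).
  now apply tsirelson_inf_admissible. }
{ exists (sum_restr tsirelson_inf [[0%nat]] x), [[0%nat]]; split; [|easy].
  apply admissible_singleton0. }
exists a, b; split; [easy|split; [easy|]].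
apply Rle_antisym.
(* The least fixed point argument: one unfolding of the equation is again closed, because the pieces
   may be bounded by [tsirelson_inf] itself, which satisfies both conditions. *)
- apply (tsirelson_inf_le (fun y c => finsupp y /\ (forall n, Rabs (y n) <= c) /\
     forall Es, admissible Es ->
       lsum (fun E => tsirelson_inf (restrict E y)) Es <= 2 * c)); [|easy|].
  + intros y c (Hy & H1 & H2); split; [easy|]; intros Es HEs.
    exists (fun E => tsirelson_inf (restrict E y)); split; [|now apply H2].
    intros E HE; assert (HF := finsupp_restrict E y Hy); repeat split; [easy| |].
    * intros n; now apply tsirelson_inf_abs.
    * intros Fs HFs; now apply tsirelson_inf_admissible.
  + split; [easy|split].
    * intros n; apply Rle_trans with a; [|apply Rmax_l].
      apply Ha; now exists n.
    * intros Es HEs; pose proof (Rmax_r a (b / 2)).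
      assert (lsum (fun E => tsirelson_inf (restrict E x)) Es <= b)
        by (apply Hb; exists Es; easy).
      lra.
- apply Rmax_lub.
  + apply Ha; intros r [n ->]; now apply tsirelson_inf_abs.
  + enough (b <= 2 * tsirelson_inf x) by lra.
    apply Hb; intros r (Es & HEs & ->); now apply tsirelson_inf_admissible.
Qed.

Section Uniqueness.

Variable f : rseq -> R.
Hypothesis Hf : TsirelsonEq f.

Lemma TsirelsonEq_abs (x : rseq) (n : nat) : finsupp x -> Rabs (x n) <= f x.
Proof.
intros Hx; destruct (Hf x Hx) as (a & b & Ha & _ & ->).
apply Rle_trans with a; [apply Ha; now exists n|apply Rmax_l].
Qed.

Lemma TsirelsonEq_admissible (x : rseq) (Es : list (list nat)) :
  finsupp x -> admissible Es -> lsum (fun E => f (restrict E x)) Es <= 2 * f x.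
Proof.
intros Hx HEs; destruct (Hf x Hx) as (a & b & _ & Hb & ->).
assert (lsum (fun E => f (restrict E x)) Es <= b) by (apply Hb; now exists Es).
pose proof (Rmax_r a (b / 2)); lra.
Qed.

(** Three singletons give 3 f(0) <= 2 f(0), whereas two would give nothing. Three sets are
    admissible from the Coq index 2 on. *)
Lemma TsirelsonEq_zero : f (fun _ => 0) = 0.
Proof.
assert (H0 : finsupp (fun _ => 0)) by (now exists 0%nat).
apply Rle_antisym.
- assert (HE : admissible [[2%nat]; [3%nat]; [4%nat]]).
  { repeat split; try easy.
    - repeat constructor; easy.
    - intros a [<-|[]]; simpl; lia.
    - intros [|[|j]] a b Hj; simpl in *; intros; lia. }
  pose proof (TsirelsonEq_admissible _ _ H0 HE) as H.
  assert (E0 : forall E, restrict E (fun _ => 0) = (fun _ => 0)).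
  { intros E; apply functional_extensionality; intros n; unfold restrict.
    now destruct (in_dec Nat.eq_dec n E). }
  simpl in H; rewrite !E0 in H; lra.
- pose proof (TsirelsonEq_abs (fun _ => 0) 0 H0) as H; cbv beta in H; rewrite Rabs_R0 in H; lra.
Qed.

Lemma tsirelson_inf_le_TsirelsonEq (x : rseq) : finsupp x -> tsirelson_inf x <= f x.
Proof.
intros Hx; apply (tsirelson_inf_le (fun y c => finsupp y /\ c = f y)); try easy.
intros y c [Hy ->]; split; [intros; now apply TsirelsonEq_abs|].
intros Es HEs; exists (fun E => f (restrict E y)); split.
- intros E HE; split; [now apply finsupp_restrict|easy].
- now apply TsirelsonEq_admissible.
Qed.

(* Induction on the size of a set [A] carrying [x]: a family in which some [E]
   contains [A] contributes exactly [f x], which the factor 1/2 makes useless. *)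
Lemma TsirelsonEq_le_tsirelson_inf (k : nat) : forall (A : list nat) (x : rseq),
  (length A <= k)%nat -> (forall n, ~ In n A -> x n = 0) -> finsupp x ->
  f x <= tsirelson_inf x.
Proof.
induction k as [|k IH]; intros A x HA Hsupp Hx.
{ destruct A; [|simpl in HA; lia].
  replace x with (fun _ : nat => 0)
    by (apply functional_extensionality; intros n; now rewrite Hsupp).
  rewrite TsirelsonEq_zero; apply Rle_trans with (Rabs 0); [apply Rabs_pos|].
  apply (tsirelson_inf_abs (fun _ => 0) 0); now exists 0%nat. }
destruct (Rle_lt_dec (f x) (tsirelson_inf x)) as [|Hlt]; [easy|exfalso].
destruct (Hf x Hx) as (a & b & Ha & Hb & E).
assert (Hax : a <= tsirelson_inf x)
  by (apply Ha; intros r [n ->]; now apply tsirelson_inf_abs).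
assert (Hpos : 0 <= tsirelson_inf x)
  by (apply Rle_trans with (Rabs (x 0%nat)); [apply Rabs_pos|now apply tsirelson_inf_abs]).
assert (Eb : f x = b / 2).
{ rewrite E; apply Rmax_right; destruct (Rle_lt_dec a (b / 2)) as [|H]; [easy|].
  rewrite Rmax_left in E; lra. }
assert (Hb' : b <= Rmax (2 * tsirelson_inf x) (f x)).
{ apply Hb; intros r (Es & HEs & ->).
  destruct (classic (exists F, In F Es /\ incl A F)) as [(F & HF & HAF)|Hno].
  - apply Rle_trans with (2 := Rmax_r _ _).
    assert (Hp := admissible_pairwise _ HEs).
    apply in_split in HF; destruct HF as (E1 & E2 & ->).
    assert (Hd : forall G n, In G E1 \/ In G E2 -> In n G -> In n F -> False).
    { clear - Hp; revert Hp; induction E1 as [|G0 E1 IH1]; simpl; intros Hp G n HG Hn HnF.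
      - inversion Hp as [|? ? H]; subst; rewrite Forall_forall in H.
        destruct HG as [[]|HG]; specialize (H G HG n n HnF Hn); lia.
      - inversion Hp as [|? ? H H']; subst; rewrite Forall_forall in H.
        destruct HG as [[<-|HG]|HG]; [|now apply (IH1 H' G n); auto..].
        assert (Hi : In F (E1 ++ F :: E2)) by (apply in_or_app; simpl; auto).
        specialize (H F Hi n n Hn HnF); lia. }
    assert (Hz : forall G, In G E1 \/ In G E2 -> f (restrict G x) = 0).
    { intros G HG; rewrite <- TsirelsonEq_zero; f_equal.
      apply functional_extensionality; intros n; unfold restrict.
      destruct (in_dec Nat.eq_dec n G) as [Hn|]; [|easy].
      apply Hsupp; intros HnA; apply (Hd G n); auto. }
    change (lsum (fun E => f (restrict E x)) (E1 ++ F :: E2) <= f x).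
    rewrite lsum_app; simpl.
    rewrite (lsum_ext _ (fun _ => 0) E1), (lsum_ext _ (fun _ => 0) E2), !lsum_const
      by auto.
    replace (restrict F x) with x; [lra|].
    apply functional_extensionality; intros n; unfold restrict.
    destruct (in_dec Nat.eq_dec n F) as [|Hn]; [easy|apply Hsupp; auto].
  - apply Rle_trans with (2 := Rmax_l _ _).
    apply Rle_trans with (2 := tsirelson_inf_admissible x Es Hx HEs).
    apply lsum_le; intros F HF.
    assert (Hex : exists n, In n A /\ ~ In n F).
    { apply NNPP; intros Hn; apply Hno; exists F; split; [easy|].
      intros n Hn'; apply NNPP; intros Hn''; apply Hn; now exists n. }
    destruct Hex as (n & HnA & HnF).
    apply (IH (remove Nat.eq_dec n A)).
    + pose proof (remove_length_lt Nat.eq_dec A n HnA); lia.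
    + intros m Hm; unfold restrict; destruct (in_dec Nat.eq_dec m F) as [Hmf|]; [|easy].
      apply Hsupp; intros HmA; apply Hm, in_in_remove; [|easy].
      now intros ->.
    + now apply finsupp_restrict. }
(* If b <= f x, then f x = b/2 forces f x <= 0; if b <= 2 [tsirelson_inf x], then f x <=
   [tsirelson_inf x]. Both contradict [Hlt]. *)
revert Hb'; apply Rmax_case; lra.
Qed.

Lemma TsirelsonEq_unique (x : rseq) : finsupp x -> f x = tsirelson_inf x.
Proof.
intros Hx; apply Rle_antisym; [|now apply tsirelson_inf_le_TsirelsonEq].
destruct Hx as [N HN] eqn:EH.
apply (TsirelsonEq_le_tsirelson_inf N (seq 0 N)); [now rewrite length_seq| |easy].
intros n Hn; apply HN; destruct (le_lt_dec N n); [easy|].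
exfalso; apply Hn, in_seq; lia.
Qed.

End Uniqueness.

Lemma Tnorm00_eq : TsirelsonEq Tnorm00.
Proof. unfold Tnorm00; apply epsilon_spec; exists tsirelson_inf; apply tsirelson_inf_eq. Qed.

Lemma Tnorm00_abs (x : rseq) (n : nat) : finsupp x -> Rabs (x n) <= Tnorm00 x.
Proof. apply TsirelsonEq_abs, Tnorm00_eq. Qed.

Lemma Tnorm00_ge0 (x : rseq) : finsupp x -> 0 <= Tnorm00 x.
Proof. intros Hx; apply Rle_trans with (2 := Tnorm00_abs x 0 Hx); apply Rabs_pos. Qed.

Lemma Tnorm00_admissible (x : rseq) (Es : list (list nat)) :
  finsupp x -> admissible Es ->
  lsum (fun E => Tnorm00 (restrict E x)) Es <= 2 * Tnorm00 x.
Proof. apply TsirelsonEq_admissible, Tnorm00_eq. Qed.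

Lemma Tnorm00_zero : Tnorm00 (fun _ => 0) = 0.
Proof. apply TsirelsonEq_zero, Tnorm00_eq. Qed.

Lemma Tnorm00_le (Q : rseq -> R -> Prop) (x : rseq) (c : R) :
  bound_closed Q -> finsupp x -> Q x c -> Tnorm00 x <= c.
Proof.
intros HQ Hx Hc; rewrite (TsirelsonEq_unique _ Tnorm00_eq) by easy.
now apply (tsirelson_inf_le Q).
Qed.

Lemma Tnorm00_le_l1 (x : rseq) (N : nat) :
  (forall n, (N <= n)%nat -> x n = 0) ->
  Tnorm00 x <= lsum (fun n => Rabs (x n)) (seq 0 N).
Proof.
intros HN; apply (Tnorm00_le l1_bound); [apply l1_bound_closed|now exists N|].
exists N; split; [easy|lra].
Qed.

(** Triangle inequality, homogeneity and lattice monotonicity in one statement. Coordinatewise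
    domination survives restriction to a set, so the relation itself is [bound_closed]. *)
Lemma Tnorm00_combine (x y z : rseq) (P Q : R) :
  0 <= P -> 0 <= Q -> finsupp x -> finsupp y ->
  (forall n, Rabs (z n) <= P * Rabs (x n) + Q * Rabs (y n)) ->
  Tnorm00 z <= P * Tnorm00 x + Q * Tnorm00 y.
Proof.
intros HP HQ Hx Hy Hz.
assert (Hfz : finsupp z).
{ destruct Hx as [N HN], Hy as [M HM]; exists (N + M)%nat; intros n Hn.
  specialize (Hz n); rewrite HN, HM, Rabs_R0 in Hz by lia.
  destruct (Req_dec (z n) 0) as [|H]; [easy|apply Rabs_pos_lt in H; lra]. }
apply (Tnorm00_le (fun z c => exists x y, finsupp x /\ finsupp y /\
  (forall n, Rabs (z n) <= P * Rabs (x n) + Q * Rabs (y n)) /\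
  c = P * Tnorm00 x + Q * Tnorm00 y)); [|easy|now exists x, y].
clear x y z Hx Hy Hz Hfz; intros z c (x & y & Hx & Hy & Hz & ->); split.
- intros n; apply Rle_trans with (1 := Hz n).
  pose proof (Tnorm00_abs x n Hx); pose proof (Tnorm00_abs y n Hy).
  apply Rplus_le_compat; now apply Rmult_le_compat_l.
- intros Es HEs.
  exists (fun E => P * Tnorm00 (restrict E x) + Q * Tnorm00 (restrict E y)); split.
  + intros E HE; exists (restrict E x), (restrict E y).
    split; [now apply finsupp_restrict|split; [now apply finsupp_restrict|]].
    split; [|easy]; intros n; unfold restrict.
    destruct (in_dec Nat.eq_dec n E); [easy|rewrite !Rabs_R0; lra].
  + rewrite lsum_plus, !lsum_scal.
    pose proof (Tnorm00_admissible x Es Hx HEs) as H1.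
    pose proof (Tnorm00_admissible y Es Hy HEs) as H2.
    apply (Rmult_le_compat_l P) in H1; [|easy].
    apply (Rmult_le_compat_l Q) in H2; [|easy].
    lra.
Qed.

Lemma Tnorm00_mono (x y : rseq) :
  finsupp y -> (forall n, Rabs (x n) <= Rabs (y n)) -> Tnorm00 x <= Tnorm00 y.
Proof.
intros Hy H; pose proof (Tnorm00_combine y y x 1 0) as HC.
specialize (HC ltac:(lra) ltac:(lra) Hy Hy).
assert (Tnorm00 x <= 1 * Tnorm00 y + 0 * Tnorm00 y) by (apply HC; intros n; specialize (H n); lra).
lra.
Qed.

(** * The norms of the convexifications *)

Definition blk (a b : nat) (x : rseq) : rseq :=
  fun i => if (Nat.leb a i && Nat.ltb i b)%bool then x i else 0.

Lemma blk_in (a b i : nat) (x : rseq) : (a <= i < b)%nat -> blk a b x i = x i.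
Proof.
intros H; unfold blk.
now rewrite (proj2 (Nat.leb_le a i)), (proj2 (Nat.ltb_lt i b)) by lia.
Qed.

Lemma blk_out (a b i : nat) (x : rseq) : ~ (a <= i < b)%nat -> blk a b x i = 0.
Proof.
intros H; unfold blk; destruct (Nat.leb_spec a i), (Nat.ltb_spec i b); simpl; lia || easy.
Qed.

Ltac blk_cases a b i :=
  destruct (classic (a <= i < b)%nat);
  [rewrite ?(blk_in a b i) by lia|rewrite ?(blk_out a b i) by lia].

Lemma finsupp_blk (a b : nat) (x : rseq) : finsupp (blk a b x).
Proof. exists b; intros n Hn; apply blk_out; lia. Qed.

Lemma blk_empty (a : nat) (x : rseq) : blk a a x = fun _ => 0.
Proof. apply functional_extensionality; intros i; apply blk_out; lia. Qed.

Lemma proj_blk (n : nat) (x : rseq) : proj n x = blk 0 n x.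
Proof.
apply functional_extensionality; intros i; unfold proj.
destruct (lt_dec i n); [rewrite blk_in|rewrite blk_out]; lia || easy.
Qed.

Lemma restrict_seq (a n : nat) (x : rseq) : restrict (seq a n) x = blk a (a + n) x.
Proof.
apply functional_extensionality; intros i; blk_cases a (a + n)%nat i.
- apply restrict_in, in_seq; lia.
- apply restrict_out; rewrite in_seq; lia.
Qed.

Lemma blk_finsupp (x : rseq) (N n : nat) :
  (forall i, (N <= i)%nat -> x i = 0) -> (N <= n)%nat -> blk 0 n x = x.
Proof.
intros HN Hn; apply functional_extensionality; intros i; blk_cases 0%nat n i; [easy|].
symmetry; apply HN; lia.
Qed.

Definition pw (s : R) (x : rseq) : rseq := fun n => rpow (Rabs (x n)) s.

Lemma pw_blk (s : R) (a b : nat) (x : rseq) : pw s (blk a b x) = blk a b (pw s x).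
Proof.
apply functional_extensionality; intros i; unfold pw at 1; blk_cases a b i; [easy|].
now rewrite Rabs_R0, rpow_0.
Qed.

Lemma finsupp_pw (s : R) (x : rseq) : finsupp x -> finsupp (pw s x).
Proof.
intros [N HN]; exists N; intros n Hn; unfold pw; now rewrite HN, Rabs_R0, rpow_0.
Qed.

Definition ns (s : R) (x : rseq) : R := rpow (Tnorm00 (pw s x)) (1 / s).

Lemma ns_ge0 (s : R) (x : rseq) : 0 <= ns s x.
Proof. apply rpow_ge0. Qed.

Lemma rpow_ns (s : R) (x : rseq) :
  1 <= s -> finsupp x -> rpow (ns s x) s = Tnorm00 (pw s x).
Proof.
intros Hs Hx; apply rpow_inv_rpow; [lra|now apply Tnorm00_ge0, finsupp_pw].
Qed.

Lemma Rabs_pw (s : R) (x : rseq) (n : nat) : Rabs (pw s x n) = rpow (Rabs (x n)) s.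
Proof. apply Rabs_pos_eq, rpow_ge0. Qed.

Lemma ns_abs (s : R) (x : rseq) (n : nat) : 1 <= s -> finsupp x -> Rabs (x n) <= ns s x.
Proof.
intros Hs Hx; apply (rpow_le_inv _ _ s); [lra|apply ns_ge0|].
rewrite rpow_ns, <- Rabs_pw by easy; now apply Tnorm00_abs, finsupp_pw.
Qed.

(** The upper s-estimate with constant one: coordinatewise |z|^s <= |x|^s + |y|^s, and the triangle
    inequality of T applies. Domination by one of two vectors at each coordinate replaces disjoint
    supports. *)
Lemma ns_disjoint (s : R) (x y z : rseq) :
  1 <= s -> finsupp x -> finsupp y -> finsupp z ->
  (forall n, Rabs (z n) <= Rabs (x n) \/ Rabs (z n) <= Rabs (y n)) ->
  rpow (ns s z) s <= rpow (ns s x) s + rpow (ns s y) s.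
Proof.
intros Hs Hx Hy Hz H; rewrite !rpow_ns by easy.
replace (Tnorm00 (pw s x) + Tnorm00 (pw s y))
  with (1 * Tnorm00 (pw s x) + 1 * Tnorm00 (pw s y)) by ring.
apply Tnorm00_combine; try lra; try now apply finsupp_pw.
intros n; rewrite !Rabs_pw.
pose proof (rpow_ge0 (Rabs (x n)) s); pose proof (rpow_ge0 (Rabs (y n)) s).
destruct (H n) as [Hn|Hn]; apply (rpow_le _ _ s) in Hn; lra.
Qed.

Lemma ns_scal_le (s c : R) (x z : rseq) :
  1 <= s -> 0 <= c -> finsupp x ->
  (forall n, Rabs (z n) <= c * Rabs (x n)) -> ns s z <= c * ns s x.
Proof.
intros Hs Hc Hx H; apply rpow_inv_le; [lra|pose proof (ns_ge0 s x); nra|].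
rewrite rpow_mult, rpow_ns by (easy || apply ns_ge0).
replace (rpow c s * Tnorm00 (pw s x))
  with (rpow c s * Tnorm00 (pw s x) + 0 * Tnorm00 (pw s x)) by ring.
apply Tnorm00_combine; try lra; try now apply finsupp_pw.
- apply rpow_ge0.
- intros n; rewrite !Rabs_pw, Rmult_0_l, Rplus_0_r, <- rpow_mult by (easy || apply Rabs_pos).
  apply rpow_le; [lra|apply H].
Qed.

Lemma ns_mono (s : R) (x z : rseq) :
  1 <= s -> finsupp x -> (forall n, Rabs (z n) <= Rabs (x n)) -> ns s z <= ns s x.
Proof.
intros Hs Hx H; rewrite <- (Rmult_1_l (ns s x)); apply ns_scal_le; try easy; try lra.
intros n; rewrite Rmult_1_l; apply H.
Qed.

Lemma ns_triangle (s : R) (x y z : rseq) :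
  1 <= s -> finsupp x -> finsupp y ->
  (forall n, Rabs (z n) <= Rabs (x n) + Rabs (y n)) -> ns s z <= ns s x + ns s y.
Proof.
intros Hs Hx Hy H; apply le_epsilon; intros e He.
pose proof (ns_ge0 s x); pose proof (ns_ge0 s y).
(* The linear bound is taken at the two norms themselves, where it is sharp; e/2 keeps both points
   positive, as [rpow_add_linear] demands. *)
set (a := ns s x + e / 2); set (b := ns s y + e / 2).
assert (Ha : 0 < a) by (unfold a; lra); assert (Hb : 0 < b) by (unfold b; lra).
replace (ns s x + ns s y + e) with (a + b) by (unfold a, b; lra).
destruct (rpow_add_linear a b s Hs Ha Hb) as (P & Q & HP & HQ & Huv & E).
apply rpow_inv_le; [lra|lra|]; rewrite <- E.
apply Rle_trans with (P * Tnorm00 (pw s x) + Q * Tnorm00 (pw s y)).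
- apply Tnorm00_combine; try easy; try now apply finsupp_pw.
  intros n; rewrite !Rabs_pw.
  apply Rle_trans with (2 := Huv _ _ (Rabs_pos _) (Rabs_pos _)).
  apply rpow_le; [lra|apply H].
- rewrite <- !rpow_ns by easy.
  apply Rplus_le_compat; apply Rmult_le_compat_l; try easy; apply rpow_le;
    unfold a, b; lra.
Qed.

Lemma ns_small (s eta : R) (N : nat) (x : rseq) :
  1 <= s -> 0 <= eta -> (forall n, (N <= n)%nat -> x n = 0) ->
  (forall n, Rabs (x n) <= eta) -> ns s x <= INR N * eta.
Proof.
intros Hs He HN H; pose proof (pos_INR N).
apply rpow_inv_le; [lra|nra|].
assert (HT : Tnorm00 (pw s x) <= INR N * rpow eta s).
{ eapply Rle_trans; [apply (Tnorm00_le_l1 _ N)|].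
  - intros n Hn; unfold pw; now rewrite HN, Rabs_R0, rpow_0.
  - apply Rle_trans with (lsum (fun _ => rpow eta s) (seq 0 N)).
    + apply lsum_le; intros n _; rewrite Rabs_pw; apply rpow_le; [lra|apply H].
    + rewrite lsum_const, length_seq; lra. }
apply Rle_trans with (1 := HT); rewrite rpow_mult by easy.
apply Rmult_le_compat_r; [apply rpow_ge0|].
destruct N as [|N]; [simpl; rewrite rpow_0; lra|].
assert (1 <= INR (S N)) by (rewrite S_INR; pose proof (pos_INR N); lra).
rewrite <- (rpow_1_r (INR (S N))) at 1 by lra; now apply rpow_le_exponent.
Qed.

Lemma ns_zero (s : R) : ns s (fun _ => 0) = 0.
Proof.
unfold ns; replace (pw s (fun _ => 0)) with (fun _ : nat => 0).
- rewrite Tnorm00_zero; apply rpow_0.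
- apply functional_extensionality; intros n; unfold pw; now rewrite Rabs_R0, rpow_0.
Qed.

(* [NB s x c]: the norm of [x] in [T^s] is at most [c]; meaningful for sequences
   of infinite support, and stable under pointwise limits. *)
Definition NB (s : R) (x : rseq) (c : R) : Prop := forall n, ns s (blk 0 n x) <= c.

Lemma Rabs_blk_le (a b : nat) (x y : rseq) :
  (forall n, Rabs (x n) <= Rabs (y n)) ->
  forall n, Rabs (blk a b x n) <= Rabs (blk a b y n).
Proof. intros H n; blk_cases a b n; [easy|lra]. Qed.

Lemma Rabs_blk_le_plus (a b : nat) (x y z : rseq) :
  (forall n, Rabs (z n) <= Rabs (x n) + Rabs (y n)) ->
  forall n, Rabs (blk a b z n) <= Rabs (blk a b x n) + Rabs (blk a b y n).
Proof. intros H n; blk_cases a b n; [easy|rewrite Rabs_R0; lra]. Qed.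

Lemma NB_ge0 (s c : R) (x : rseq) : NB s x c -> 0 <= c.
Proof. intros H; apply Rle_trans with (2 := H 0%nat), ns_ge0. Qed.

Lemma NB_le (s c c' : R) (x : rseq) : NB s x c -> c <= c' -> NB s x c'.
Proof. intros H Hc n; specialize (H n); lra. Qed.

Lemma NB_triangle (s a b : R) (x y z : rseq) :
  1 <= s -> NB s x a -> NB s y b ->
  (forall n, Rabs (z n) <= Rabs (x n) + Rabs (y n)) -> NB s z (a + b).
Proof.
intros Hs Hx Hy H n; apply Rle_trans with (2 := Rplus_le_compat _ _ _ _ (Hx n) (Hy n)).
apply ns_triangle; try easy; try apply finsupp_blk; now apply Rabs_blk_le_plus.
Qed.

Lemma NB_disjoint (s a b c : R) (x y z : rseq) :
  1 <= s -> NB s x a -> NB s y b -> 0 <= c ->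
  (forall n, Rabs (z n) <= Rabs (x n) \/ Rabs (z n) <= Rabs (y n)) ->
  rpow a s + rpow b s <= rpow c s -> NB s z c.
Proof.
intros Hs Hx Hy Hc H Habc n; apply (rpow_le_inv _ _ s); [lra|easy|].
apply Rle_trans with (2 := Habc).
apply Rle_trans with (rpow (ns s (blk 0 n x)) s + rpow (ns s (blk 0 n y)) s).
- apply ns_disjoint; try easy; try apply finsupp_blk.
  intros i; blk_cases 0%nat n i; [easy|left; lra].
- apply Rplus_le_compat; apply rpow_le; auto; lra.
Qed.

Lemma NB_abs (s c : R) (x : rseq) (n : nat) : 1 <= s -> NB s x c -> Rabs (x n) <= c.
Proof.
intros Hs H; apply Rle_trans with (2 := H (S n)).
rewrite <- (blk_in 0 (S n) n x) by lia; apply ns_abs; [easy|apply finsupp_blk].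
Qed.

Lemma NB_finsupp (s c : R) (x : rseq) : 1 <= s -> finsupp x -> NB s x c <-> ns s x <= c.
Proof.
intros Hs Hx; split.
- intros H; destruct Hx as [N HN].
  rewrite <- (blk_finsupp x N N) by (easy || lia); apply H.
- intros H n; apply Rle_trans with (2 := H), ns_mono; try easy.
  intros i; blk_cases 0%nat n i; [lra|rewrite Rabs_R0; apply Rabs_pos].
Qed.

Lemma Tnorm_cv (y : rseq) (C : R) :
  (forall n, Tnorm00 (blk 0 n y) <= C) -> Un_cv (fun n => Tnorm00 (proj n y)) (Tnorm y).
Proof.
intros H; unfold Tnorm; apply epsilon_spec.
destruct (growing_cv (fun n => Tnorm00 (proj n y))) as [l Hl]; [| |now exists l].
- intros n; rewrite !proj_blk; apply Tnorm00_mono; [apply finsupp_blk|].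
  intros i; blk_cases 0%nat n i; [rewrite blk_in by lia; lra|rewrite Rabs_R0; apply Rabs_pos].
- exists C; intros r [n ->]; rewrite proj_blk; apply H.
Qed.

Lemma Tnorm_le_iff (y : rseq) (C c : R) :
  (forall n, Tnorm00 (blk 0 n y) <= C) ->
  Tnorm y <= c <-> (forall n, Tnorm00 (blk 0 n y) <= c).
Proof.
intros H; assert (Hcv := Tnorm_cv y C H); split.
- intros Hc n; apply Rle_trans with (2 := Hc); rewrite <- proj_blk.
  apply (growing_ineq (fun n => Tnorm00 (proj n y))); [|easy].
  intros m; rewrite !proj_blk; apply Tnorm00_mono; [apply finsupp_blk|].
  intros i; blk_cases 0%nat m i; [rewrite blk_in by lia; lra|rewrite Rabs_R0; apply Rabs_pos].
- intros Hc; destruct (Rle_lt_dec (Tnorm y) c) as [|Hlt]; [easy|].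
  destruct (Hcv (Tnorm y - c)) as [N HN]; [lra|].
  specialize (HN N (Nat.le_refl N)); specialize (Hc N).
  rewrite proj_blk in HN; unfold R_dist in HN; apply Rabs_def2 in HN; lra.
Qed.

Lemma NB_Tnorm00 (s c : R) (x : rseq) :
  1 <= s -> 0 <= c -> NB s x c <-> (forall n, Tnorm00 (blk 0 n (pw s x)) <= rpow c s).
Proof.
intros Hs Hc; split; intros H n; specialize (H n).
- rewrite <- pw_blk, <- rpow_ns by (easy || apply finsupp_blk).
  apply rpow_le; lra.
- rewrite <- pw_blk, <- rpow_ns in H by (easy || apply finsupp_blk).
  apply rpow_le_inv in H; lra.
Qed.

(** The bridge from the norm of the theorem to [NB]. [Tnorm] is chosen by [epsilon], so some a
    priori bound [C] is needed to know that the partial norms converge to it. *)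
Lemma Trnorm_le_iff (s c C : R) (x : rseq) :
  1 <= s -> NB s x C -> 0 <= c -> Trnorm s x <= c <-> NB s x c.
Proof.
intros Hs HC Hc; assert (HC0 := NB_ge0 _ _ _ HC).
pose proof (proj1 (NB_Tnorm00 s C x Hs HC0) HC) as HC1; clear HC; rename HC1 into HC.
rewrite NB_Tnorm00 by easy; unfold Trnorm; fold (pw s x).
assert (Hge : 0 <= Tnorm (pw s x)).
{ destruct (Rle_lt_dec 0 (Tnorm (pw s x))) as [|Hn]; [easy|].
  assert (Hle := proj1 (Tnorm_le_iff (pw s x) _ _ HC) (Rle_refl _) 0%nat).
  pose proof (Tnorm00_ge0 _ (finsupp_blk 0 0 (pw s x))); lra. }
rewrite <- (Tnorm_le_iff (pw s x) _ _ HC); split; intros H.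
- apply rpow_le_of_inv; lra.
- apply rpow_inv_le; lra.
Qed.

Lemma Trnorm_finsupp (s : R) (x : rseq) : 1 <= s -> finsupp x -> Trnorm s x = ns s x.
Proof.
intros Hs Hx; assert (H : NB s x (ns s x)) by (apply NB_finsupp; [easy|easy|lra]).
pose proof (ns_ge0 s x); apply Rle_antisym.
- now apply (Trnorm_le_iff s _ _ _ Hs H).
- apply NB_finsupp; try easy; apply (Trnorm_le_iff s _ _ _ Hs H); [apply rpow_ge0|lra].
Qed.

Definition cut (N : nat) (x : rseq) : rseq := fun i => if Nat.ltb i N then 0 else x i.

Lemma cut_lt (N i : nat) (x : rseq) : (i < N)%nat -> cut N x i = 0.
Proof. intros H; unfold cut; destruct (Nat.ltb_spec i N); lia || easy. Qed.

Lemma cut_ge (N i : nat) (x : rseq) : (N <= i)%nat -> cut N x i = x i.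
Proof. intros H; unfold cut; destruct (Nat.ltb_spec i N); lia || easy. Qed.

Lemma blk_cut (a b N : nat) (x : rseq) : blk a b (cut N x) = blk (max a N) b x.
Proof.
apply functional_extensionality; intros i; blk_cases a b i.
- destruct (le_lt_dec N i).
  + rewrite cut_ge, blk_in by lia; easy.
  + rewrite cut_lt, blk_out by lia; easy.
- now rewrite blk_out by lia.
Qed.

(** The Cauchy condition with eps = 1: a block starting at [N] is dominated by a difference of two
    partial sums of [pw s x]. *)
Lemma inTr_tail (s : R) (x : rseq) : 1 <= s -> inTr s x -> exists N, NB s (cut N x) 1.
Proof.
intros Hs Hx; destruct (Hx 1 ltac:(lra)) as [N HN]; exists N.
apply NB_Tnorm00; [easy|lra|]; intros n; rewrite rpow_1_l.
specialize (HN (max n N) N ltac:(lia) ltac:(lia)).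
apply Rlt_le, Rle_lt_trans with (2 := HN).
apply Tnorm00_mono.
- exists (max n N); intros i Hi; unfold rsub; rewrite !proj_blk, !blk_out by lia; ring.
- intros i; unfold rsub; rewrite !proj_blk, <- pw_blk, Rabs_pw, blk_cut.
  blk_cases (max 0 N) n i.
  + rewrite blk_in, blk_out by lia.
    rewrite Rminus_0_r, (Rabs_pos_eq (rpow _ _)) by apply rpow_ge0; lra.
  + rewrite Rabs_R0, rpow_0; apply Rabs_pos.
Qed.

Lemma inTr_NB (s : R) (x : rseq) : 1 <= s -> inTr s x -> exists C, NB s x C.
Proof.
intros Hs Hx; destruct (inTr_tail s x Hs Hx) as [N HN].
exists (ns s (blk 0 N x) + 1).
apply NB_triangle with (blk 0 N x) (cut N x); try easy.
- apply NB_finsupp; [easy|apply finsupp_blk|lra].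
- intros n; blk_cases 0%nat N n.
  + rewrite cut_lt, Rabs_R0 by lia; lra.
  + rewrite cut_ge, Rabs_R0 by lia; lra.
Qed.

Lemma inTr_finsupp (s : R) (x : rseq) : finsupp x -> inTr s x.
Proof.
intros Hx; apply (finsupp_pw s) in Hx; destruct Hx as [N HN].
intros eps He; exists N; intros m n Hm Hn; fold (pw s x).
rewrite !proj_blk, !(blk_finsupp (pw s x) N) by easy.
replace (rsub (pw s x) (pw s x)) with (fun _ : nat => 0).
- now rewrite Tnorm00_zero.
- apply functional_extensionality; intros i; unfold rsub; ring.
Qed.

(** * Lower estimates on successive blocks *)

(* Successive, possibly empty, intervals [[a, b)] starting at [lo] or later. *)
Fixpoint chain (lo : nat) (bl : list (nat * nat)) : Prop :=
  match bl with
  | [] => True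
  | (a, b) :: bl' => (lo <= a <= b)%nat /\ chain b bl'
  end.

Lemma chain_weaken (bl : list (nat * nat)) (lo lo' : nat) :
  (lo' <= lo)%nat -> chain lo bl -> chain lo' bl.
Proof. destruct bl as [|[a b] bl]; simpl; intuition lia. Qed.

Lemma chain_app (bl1 bl2 : list (nat * nat)) (lo N : nat) :
  chain lo bl1 -> (forall p, In p bl1 -> (snd p <= N)%nat) -> (lo <= N)%nat ->
  chain N bl2 -> chain lo (bl1 ++ bl2).
Proof.
revert lo; induction bl1 as [|[a b] bl1 IH]; simpl; intros lo H1 HN Hlo H2.
- now apply chain_weaken with N.
- split; [easy|apply IH; try easy; auto].
  apply (HN (a, b)); auto.
Qed.

Lemma chain_filter (f : nat * nat -> bool) (bl : list (nat * nat)) (lo : nat) :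
  chain lo bl -> chain lo (filter f bl).
Proof.
revert lo; induction bl as [|[a b] bl IH]; simpl; intros lo H; [easy|].
destruct (f (a, b)); simpl; [intuition|].
apply chain_weaken with b; [lia|intuition].
Qed.

(** Each nonempty interval pushes the left end by at least one, so dropping [h] of them buys room
    for the bound on the number of sets in [admissible]. *)
Lemma chain_skipn (h : nat) : forall (bl : list (nat * nat)) (lo : nat),
  chain lo bl -> (forall p, In p bl -> (fst p < snd p)%nat) ->
  (h <= length bl)%nat -> chain (lo + h) (skipn h bl).
Proof.
induction h as [|h IH]; intros bl lo H Hs Hh; [now rewrite Nat.add_0_r|].
destruct bl as [|[a b] bl]; [simpl in Hh; lia|]; simpl in *.
apply chain_weaken with (b + h)%nat;
  [specialize (Hs (a, b) (or_introl eq_refl)); simpl in Hs; lia|].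
apply IH; [easy|auto|lia].
Qed.

Lemma chain_admissible (bl : list (nat * nat)) (lo : nat) :
  bl <> [] -> chain lo bl -> (forall p, In p bl -> (fst p < snd p)%nat) ->
  (length bl <= S lo)%nat ->
  admissible (map (fun p => seq (fst p) (snd p - fst p)) bl).
Proof.
intros Hne Hc Hs Hl; repeat split.
- now destruct bl.
- apply Forall_forall; intros E HE; apply in_map_iff in HE.
  destruct HE as ([a b] & <- & Hp); specialize (Hs _ Hp); simpl in *.
  destruct (b - a)%nat eqn:E; [lia|easy].
- rewrite length_map; intros i Hi; destruct bl as [|[a b] bl]; [easy|].
  simpl in Hi; apply in_seq in Hi; simpl in Hc; lia.
- clear Hne Hl; revert lo Hc; induction bl as [|[a b] bl IH]; intros lo Hc j i i' Hj;
    [simpl in Hj; lia|].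
  destruct j as [|j].
  + destruct bl as [|[a' b'] bl]; [simpl in Hj; lia|]; simpl.
    rewrite !in_seq; simpl in Hc; lia.
  + simpl map; simpl nth; apply (IH (fun p Hp => Hs p (or_intror Hp)) b).
    * simpl in Hc; easy.
    * simpl in Hj; lia.
Qed.

Lemma Tnorm00_chain (bl : list (nat * nat)) (lo : nat) (x : rseq) :
  finsupp x -> chain lo bl -> (forall p, In p bl -> (fst p < snd p)%nat) ->
  (length bl <= S lo)%nat ->
  lsum (fun p => Tnorm00 (blk (fst p) (snd p) x)) bl <= 2 * Tnorm00 x.
Proof.
intros Hx Hc Hs Hl; destruct bl as [|p bl]; [simpl; pose proof (Tnorm00_ge0 x Hx); lra|].
apply Rle_trans with (2 := Tnorm00_admissible x _ Hx
  (chain_admissible (p :: bl) lo ltac:(easy) Hc Hs Hl)).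
rewrite lsum_map; apply lsum_le; intros q Hq; apply Req_le.
rewrite restrict_seq; do 2 f_equal; specialize (Hs q Hq); lia.
Qed.

Lemma skipn_incl {A : Type} (n : nat) (l : list A) : incl (skipn n l) l.
Proof. intros a Ha; rewrite <- (firstn_skipn n l); apply in_or_app; auto. Qed.

(* Among [n] nonempty successive intervals the last half is admissible. *)
Lemma Tnorm00_count (bl : list (nat * nat)) (x : rseq) (tau : R) :
  finsupp x -> 0 < tau -> chain 0 bl ->
  (forall p, In p bl -> tau <= Tnorm00 (blk (fst p) (snd p) x)) ->
  tau * INR (length bl) <= 4 * Tnorm00 x.
Proof.
intros Hx Ht Hc Hb.
assert (Hs : forall lo, chain lo bl -> forall p, In p bl -> (fst p < snd p)%nat).
{ clear Hc; induction bl as [|[a b] bl IH]; intros lo Hc p Hp; [easy|].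
  simpl in Hc; destruct Hp as [<-|Hp].
  - simpl; destruct (Nat.eq_dec a b) as [<-|]; [|lia].
    specialize (Hb (a, a) (or_introl eq_refl)); simpl in Hb.
    rewrite blk_empty, Tnorm00_zero in Hb; lra.
  - apply (IH (fun q Hq => Hb q (or_intror Hq)) b); easy. }
(* At most h + 1 intervals remain after dropping [h], and they start at the Coq index [h] or later,
   which is just enough. The factor 4 is 2 from the Tsirelson equation times 2 from the halving. *)
specialize (Hs 0%nat Hc); set (h := (length bl / 2)%nat).
assert (Hh : (2 * h <= length bl <= 2 * h + 1)%nat).
{ pose proof (Nat.div_mod_eq (length bl) 2); pose proof (Nat.mod_upper_bound (length bl) 2).
  unfold h; lia. }
assert (H : lsum (fun p => Tnorm00 (blk (fst p) (snd p) x)) (skipn h bl) <= 2 * Tnorm00 x).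
{ apply Tnorm00_chain with h; [easy| | |].
  - apply (chain_skipn h bl 0); [easy|easy|lia].
  - intros p Hp; apply Hs; now apply skipn_incl in Hp.
  - rewrite length_skipn; lia. }
assert (H' : lsum (fun _ => tau) (skipn h bl) <= 2 * Tnorm00 x).
{ apply Rle_trans with (2 := H), lsum_le; intros p Hp; apply Hb.
  now apply skipn_incl in Hp. }
rewrite lsum_const, length_skipn in H'.
assert (INR (length bl) <= 2 * INR (length bl - h)).
{ replace 2 with (INR 2) by (simpl; lra); rewrite <- mult_INR; apply le_INR; lia. }
nra.
Qed.

Lemma exists_min_split (l : list R) :
  l <> [] -> exists l1 m l2, l = l1 ++ m :: l2 /\ forall a, In a l -> m <= a.
Proof.
induction l as [|a l IH]; intros H; [easy|].
destruct l as [|b l].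
- exists [], a, []; split; [easy|]; intros c [<-|[]]; lra.
- destruct IH as (l1 & m & l2 & E & Hm); [easy|].
  destruct (Rle_lt_dec a m).
  + exists [], a, (b :: l); split; [easy|].
    intros c [<-|Hc]; [lra|specialize (Hm c Hc); lra].
  + exists (a :: l1), m, l2; split; [simpl; now rewrite E|].
    intros c [<-|Hc]; [lra|auto].
Qed.

Definition count_ge (tau : R) (l : list R) : nat :=
  length (filter (fun a => if Rle_dec tau a then true else false) l).

(** The telescoping form of the integral test for the sum of n^(-1-e). It combines the tangent to
    exp at -e ln(n+1) with ln(n+1) - ln n >= 1/(n+1). *)
Lemma zeta_step (n : nat) (e : R) :
  0 < e -> (1 <= n)%nat ->
  e * rpow (INR (S n)) (- (1 + e)) <= rpow (INR n) (- e) - rpow (INR (S n)) (- e).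
Proof.
intros He Hn; assert (Hn1 : 1 <= INR n) by (apply (le_INR 1); lia).
rewrite S_INR; set (a := INR n) in *.
replace (- (1 + e)) with (- e + - (1)) by ring.
rewrite rpow_plus_r, (rpow_Ropp_r (a + 1) 1), rpow_1_r by lra.
assert (Hp := rpow_gt0 (a + 1) (- e) ltac:(lra)).
enough (rpow (a + 1) (- e) * (1 + e * / (a + 1)) <= rpow a (- e)) by lra.
rewrite !rpow_pos_eq by lra; unfold Rpower.
apply Rle_trans with (2 := exp_tangent (- e * ln a) (- e * ln (a + 1))).
apply Rmult_le_compat_l; [apply Rlt_le, exp_pos|].
enough (/ (a + 1) <= ln (a + 1) - ln a) by nra.
assert (Hd : 0 < / (a + 1)) by (apply Rinv_0_lt_compat; lra).
assert (E : 1 - / (a + 1) = a / (a + 1)) by (field; lra).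
pose proof (exp_tangent (- / (a + 1)) 0) as Ht.
rewrite exp_0 in Ht.
assert (a / (a + 1) <= exp (- / (a + 1))) by lra.
assert (Hl : ln (a / (a + 1)) <= - / (a + 1)).
{ rewrite <- (ln_exp (- / (a + 1))).
  destruct H as [H|H]; [|rewrite H; lra].
  apply Rlt_le, ln_increasing; [apply Rdiv_lt_0_compat; lra|easy]. }
unfold Rdiv in Hl; rewrite ln_mult, ln_Rinv in Hl by lra; lra.
Qed.

(* A list of weak-l_1 norm [D] lies in l_{1+e}: remove the minimum, which is at
   most [D / n] in a list of length [n]. *)
Lemma weak_l1_lsum (e D : R) : 0 < e -> 0 <= D ->
  forall (n : nat) (l : list R), length l = n -> (forall a, In a l -> 0 <= a) ->
  (forall tau, 0 < tau -> tau * INR (count_ge tau l) <= D) ->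
  lsum (fun a => rpow a (1 + e)) l <=
    rpow D (1 + e) * (1 + / e - / e * rpow (INR (max 1 n)) (- e)).
Proof.
intros He HD; assert (He' : 0 < / e) by now apply Rinv_0_lt_compat.
assert (HD' := rpow_ge0 D (1 + e)).
induction n as [|n IH]; intros l Hl Hpos Hcount.
{ destruct l; [|easy]; simpl; rewrite rpow_1_l; nra. }
destruct (exists_min_split l) as (l1 & m & l2 & -> & Hm); [now destruct l|].
assert (HSn : 0 < INR (S n)) by (apply lt_0_INR; lia).
assert (Hmin : rpow m (1 + e) <= rpow D (1 + e) * rpow (INR (S n)) (- (1 + e))).
{ destruct (Rle_lt_dec m 0) as [Hm0|Hm0].
  - rewrite rpow_nonpos by easy; apply Rmult_le_pos; apply rpow_ge0.
  - specialize (Hcount m Hm0); unfold count_ge in Hcount.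
    rewrite forallb_filter_id, Hl in Hcount.
    + rewrite rpow_Ropp_r by easy; assert (Hp := rpow_gt0 (INR (S n)) (1 + e) HSn).
      apply Rmult_le_reg_r with (1 := Hp).
      rewrite Rmult_assoc, Rinv_l, Rmult_1_r, <- rpow_mult by lra.
      apply rpow_le; lra.
    + apply forallb_forall; intros a Ha; specialize (Hm a Ha).
      destruct (Rle_dec m a); [easy|lra]. }
assert (Hrest : lsum (fun a => rpow a (1 + e)) (l1 ++ l2) <=
    rpow D (1 + e) * (1 + / e - / e * rpow (INR (max 1 n)) (- e))).
{ apply IH.
  - rewrite length_app in *; simpl in Hl; lia.
  - intros a Ha; apply Hpos; apply in_app_iff in Ha; apply in_app_iff; simpl; intuition.
  - intros tau Ht; apply Rle_trans with (2 := Hcount tau Ht).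
    apply Rmult_le_compat_l; [lra|]; apply le_INR; unfold count_ge.
    rewrite !filter_app, !length_app; simpl; destruct (Rle_dec tau m); simpl; lia. }
replace (lsum (fun a => rpow a (1 + e)) (l1 ++ m :: l2))
  with (rpow m (1 + e) + lsum (fun a => rpow a (1 + e)) (l1 ++ l2))
  by (rewrite !lsum_app; simpl; ring).
(* A single entry accounts for the summand 1 of the constant; from two entries on, the new term is
   absorbed by [zeta_step]. The [max 1 n] keeps the bound meaningful for the empty list. *)
destruct n as [|n].
- destruct l1, l2; try (rewrite length_app in Hl; simpl in Hl; lia).
  simpl lsum; simpl INR in *; rewrite !rpow_1_l in *; lra.
- pose proof (zeta_step (S n) e He ltac:(lia)) as Hz.
  replace (max 1 (S n)) with (S n) in Hrest by lia.
  replace (max 1 (S (S n))) with (S (S n)) by lia.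
  set (u := rpow (INR (S (S n))) (- (1 + e))) in *.
  set (v := rpow (INR (S n)) (- e)) in *; set (w := rpow (INR (S (S n))) (- e)) in *.
  apply Rle_trans with (rpow D (1 + e) * (u + (1 + / e - / e * v))); [lra|].
  apply Rmult_le_compat_l; [easy|].
  apply (Rmult_le_compat_l (/ e)) in Hz; [|lra].
  rewrite <- Rmult_assoc, Rinv_l in Hz by lra; lra.
Qed.

(** By [Tnorm00_count], applied to the blocks above each level, the block norms have weak l_1 norm
    at most 4 times that of [x], however many blocks there are. The constant blows up as [rho] tends
    to 1. *)
Lemma Tnorm00_lower_estimate (rho : R) : 1 < rho ->
  exists Z, 0 < Z /\ forall (x : rseq) (bl : list (nat * nat)),
    finsupp x -> chain 0 bl ->
    lsum (fun p => rpow (Tnorm00 (blk (fst p) (snd p) x)) rho) bl <=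
      Z * rpow (Tnorm00 x) rho.
Proof.
intros Hr; set (e := rho - 1); assert (He : 0 < e) by (unfold e; lra).
assert (He' : 0 < / e) by now apply Rinv_0_lt_compat.
exists (rpow 4 rho * (1 + / e)); split.
{ apply Rmult_lt_0_compat; [apply rpow_gt0; lra|lra]. }
intros x bl Hx Hc; assert (Hx0 := Tnorm00_ge0 x Hx).
rewrite <- (lsum_map (fun p => Tnorm00 (blk (fst p) (snd p) x)) (fun a => rpow a rho)).
replace rho with (1 + e) by (unfold e; ring).
eapply Rle_trans.
- apply (weak_l1_lsum e (4 * Tnorm00 x)) with (n := length bl); [easy|lra| | |].
  + apply length_map.
  + intros a Ha; apply in_map_iff in Ha; destruct Ha as (p & <- & _).
    apply Tnorm00_ge0, finsupp_blk.
  + intros tau Ht; unfold count_ge; rewrite filter_map_swap, length_map.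
    apply Tnorm00_count; [easy|easy|now apply chain_filter|].
    intros p Hp; apply filter_In in Hp; destruct Hp as [_ Hp].
    now destruct (Rle_dec tau (Tnorm00 (blk (fst p) (snd p) x))).
- rewrite rpow_mult by lra.
  pose proof (rpow_ge0 4 (1 + e)); pose proof (rpow_ge0 (Tnorm00 x) (1 + e)).
  pose proof (rpow_ge0 (INR (max 1 (length bl))) (- e)).
  rewrite (Rmult_assoc (rpow 4 (1 + e)) (1 + / e)), (Rmult_comm (1 + / e)), <- Rmult_assoc.
  apply Rmult_le_compat_l; nra.
Qed.

Lemma chain_bound (bl : list (nat * nat)) :
  exists n, forall p, In p bl -> (snd p <= n)%nat.
Proof.
induction bl as [|p bl [n IH]]; [now exists 0%nat|].
exists (max (snd p) n); intros q [<-|Hq]; [lia|specialize (IH q Hq); lia].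
Qed.

Lemma blk_blk0 (a b n : nat) (x : rseq) : (b <= n)%nat -> blk a b (blk 0 n x) = blk a b x.
Proof.
intros H; apply functional_extensionality; intros i; blk_cases a b i; [|easy].
apply blk_in; lia.
Qed.

(* [c] bounds the [r]-th power of an equivalent norm of [T^s] which satisfies a lower
   [r]-estimate with constant one. *)
Definition NPr (s r c : R) (x : rseq) : Prop :=
  forall bl, chain 0 bl ->
    lsum (fun p => rpow (ns s (blk (fst p) (snd p) x)) r) bl <= c.

(** The estimate in T for rho = r/s, since an r-th power of the norm of T^s is an (r/s)-th power of
    a norm in T. With [NPr_NB] it gives the equivalence of the two norms. *)
Lemma NB_NPr (s r : R) : 1 <= s -> s < r ->
  exists Z, 0 < Z /\ forall x c, NB s x c -> NPr s r (Z * rpow c r) x.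
Proof.
intros Hs Hr; assert (Hrho : 1 < r / s).
{ apply Rmult_lt_reg_r with s; [lra|]; unfold Rdiv; rewrite Rmult_assoc, Rinv_l; lra. }
destruct (Tnorm00_lower_estimate (r / s) Hrho) as (Z & HZ & H).
exists Z; split; [easy|]; intros x c Hc bl Hbl.
destruct (chain_bound bl) as [n Hn].
assert (E : forall y, finsupp y -> rpow (ns s y) r = rpow (Tnorm00 (pw s y)) (r / s)).
{ intros y Hy; rewrite <- rpow_ns, rpow_rpow by easy; f_equal; field; lra. }
apply Rle_trans with (Z * rpow (ns s (blk 0 n x)) r).
- rewrite E by apply finsupp_blk.
  apply Rle_trans with (2 := H _ bl (finsupp_pw s _ (finsupp_blk 0 n x)) Hbl).
  apply lsum_le; intros p Hp; rewrite E by apply finsupp_blk; apply Req_le.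
  now rewrite <- pw_blk, blk_blk0 by auto.
- apply Rmult_le_compat_l; [lra|apply rpow_le; [lra|apply Hc]].
Qed.

Lemma NPr_NB (s r c : R) (x : rseq) : 0 < r -> 0 <= c -> NPr s r (rpow c r) x -> NB s x c.
Proof.
intros Hr Hc H n; apply (rpow_le_inv _ _ r); [easy|easy|].
specialize (H [(0, n)%nat]); simpl in H; rewrite Rplus_0_r in H; apply H; lia.
Qed.

(* Bounded completeness of the unit vector basis. *)
Lemma NB_tail_small (s c eps : R) (x : rseq) :
  1 <= s -> NB s x c -> 0 < eps -> exists N, NB s (cut N x) eps.
Proof.
intros Hs Hc He; apply NNPP; intros Hno.
assert (Hstep : forall N, exists n, (N <= n)%nat /\ eps < ns s (blk N n x)).
{ intros N; apply NNPP; intros H; apply Hno; exists N; intros n.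
  destruct (Rle_lt_dec (ns s (blk 0 n (cut N x))) eps) as [|Hlt]; [easy|].
  exfalso; apply H; exists (max n N); split; [lia|].
  apply Rlt_le_trans with (1 := Hlt), ns_mono; [easy|apply finsupp_blk|].
  intros i; rewrite blk_cut; blk_cases (max 0 N) n i.
  - rewrite blk_in by lia; lra.
  - rewrite Rabs_R0; apply Rabs_pos. }
assert (Hbl : forall j, exists bl e, chain 0 bl /\ length bl = j /\
  forall p, In p bl -> (snd p <= e)%nat /\ eps < ns s (blk (fst p) (snd p) x)).
{ induction j as [|j (bl & e & H1 & H2 & H3)]; [now exists [], 0%nat|].
  destruct (Hstep e) as (n & Hn & Hlt).
  exists (bl ++ [(e, n)]), n; repeat split.
  - apply chain_app with e; [easy|apply H3|lia|simpl; lia].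
  - rewrite length_app; simpl; lia.
  - apply in_app_iff in H; destruct H as [H|[<-|[]]]; simpl; [|lia].
    specialize (H3 p H); lia.
  - apply in_app_iff in H; destruct H as [H|[<-|[]]]; simpl; [now apply H3|easy]. }
(* Any exponent above [s] would do: [j] successive blocks of norm above [eps] give j eps^(s+1) <= Z
   c^(s+1), which fails for large [j]. *)
destruct (NB_NPr s (s + 1) Hs ltac:(lra)) as (Z & HZ & HN).
specialize (HN x c Hc).
assert (Hp := rpow_gt0 eps (s + 1) He).
destruct (INR_archimed (rpow eps (s + 1)) (Z * rpow c (s + 1)) Hp) as [j Hj].
destruct (Hbl j) as (bl & e & H1 & <- & H3); specialize (HN bl H1).
assert (H : lsum (fun _ => rpow eps (s + 1)) bl <=
  lsum (fun p => rpow (ns s (blk (fst p) (snd p) x)) (s + 1)) bl).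
{ apply lsum_le; intros p Hp'; apply rpow_le; [lra|apply Rlt_le, H3, Hp']. }
rewrite lsum_const in H; lra.
Qed.

Lemma NPr_mono (s r c c' : R) (x y : rseq) :
  1 <= s -> 0 <= r -> NPr s r c x -> c <= c' ->
  (forall n, Rabs (y n) <= Rabs (x n)) -> NPr s r c' y.
Proof.
intros Hs Hr H Hc Hxy bl Hbl; apply Rle_trans with (2 := Hc), Rle_trans with (2 := H bl Hbl).
apply lsum_le; intros p _; apply rpow_le; [easy|].
apply ns_mono; [easy|apply finsupp_blk|now apply Rabs_blk_le].
Qed.

Lemma NPr_triangle (s r a b : R) (x y z : rseq) :
  1 <= s -> 1 <= r -> 0 < a -> 0 < b ->
  NPr s r (rpow a r) x -> NPr s r (rpow b r) y ->
  (forall n, Rabs (z n) <= Rabs (x n) + Rabs (y n)) -> NPr s r (rpow (a + b) r) z.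
Proof.
intros Hs Hr Ha Hb Hx Hy Hz bl Hbl.
destruct (rpow_add_linear a b r Hr Ha Hb) as (P & Q & HP & HQ & Huv & <-).
specialize (Hx bl Hbl); specialize (Hy bl Hbl).
apply (Rmult_le_compat_l P) in Hx; [|easy]; apply (Rmult_le_compat_l Q) in Hy; [|easy].
apply Rle_trans with (2 := Rplus_le_compat _ _ _ _ Hx Hy).
rewrite <- !lsum_scal, <- lsum_plus; apply lsum_le; intros p _.
apply Rle_trans with (2 := Huv _ _ (ns_ge0 _ _) (ns_ge0 _ _)).
apply rpow_le; [lra|].
apply ns_triangle; try easy; try apply finsupp_blk; now apply Rabs_blk_le_plus.
Qed.

Lemma NPr_double (s r c : R) (x y z : rseq) :
  1 <= s -> 1 <= r -> 0 < c -> NPr s r c x -> NPr s r c y ->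
  (forall n, Rabs (z n) <= Rabs (x n) + Rabs (y n)) -> NPr s r (rpow 2 r * c) z.
Proof.
intros Hs Hr Hc Hx Hy Hz; set (a := rpow c (1 / r)).
assert (Ha : 0 < a) by now apply rpow_gt0.
assert (E : rpow a r = c) by (apply rpow_inv_rpow; lra).
replace (rpow 2 r * c) with (rpow (a + a) r).
- apply NPr_triangle with x y; try easy; rewrite E; easy.
- replace (a + a) with (2 * a) by ring; rewrite rpow_mult, E by lra; easy.
Qed.

(** The lower r-estimate with constant one: a chain witnessing more than [B] on the head, followed
    by any chain on the tail, is one chain for [x]. The negated hypothesis stands for a lower bound
    on the norm of the head. *)
Lemma NPr_split (s r A B : R) (N : nat) (x : rseq) :
  1 <= s -> 0 <= r ->
  NPr s r A x -> ~ NPr s r B (blk 0 N x) -> NPr s r (A - B) (cut N x).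
Proof.
intros Hs Hr HA HB bl2 Hbl2.
assert (HB' : exists bl, chain 0 bl /\
  B < lsum (fun p => rpow (ns s (blk (fst p) (snd p) (blk 0 N x))) r) bl).
{ apply NNPP; intros H; apply HB; intros bl Hbl; apply Rnot_lt_le; intros Hlt.
  apply H; now exists bl. }
destruct HB' as (bl1 & Hbl1 & Hlt).
(* Clipping at [N] makes the two chains concatenable. It may create empty intervals, which [chain]
   tolerates. *)
set (c1 := map (fun p => (min (fst p) N, min (snd p) N)) bl1).
set (c2 := map (fun p => (max (fst p) N, max (snd p) N)) bl2).
assert (H1 : forall lo, chain lo bl1 -> chain (min lo N) c1).
{ unfold c1; clear; induction bl1 as [|[a b] bl IH]; simpl; intros lo H; [easy|].
  split; [lia|now apply IH]. }
assert (H2 : forall lo, chain lo bl2 -> chain (max lo N) c2).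
{ unfold c2; clear; induction bl2 as [|[a b] bl IH]; simpl; intros lo H; [easy|].
  split; [lia|now apply IH]. }
assert (H : chain 0 (c1 ++ c2)).
{ apply chain_app with N; [now apply (H1 0%nat)| |lia|now apply (H2 0%nat)].
  intros p Hp; apply in_map_iff in Hp; destruct Hp as (q & <- & _); simpl; lia. }
specialize (HA _ H); rewrite lsum_app in HA; unfold c1, c2 in HA.
rewrite !lsum_map in HA; simpl in HA.
rewrite (lsum_ext _ (fun p => rpow (ns s (blk (fst p) (snd p) (blk 0 N x))) r) bl1) in HA.
- rewrite (lsum_ext _ (fun p => rpow (ns s (blk (fst p) (snd p) (cut N x))) r) bl2) in HA;
    [lra|].
  intros p _; do 2 f_equal; apply functional_extensionality; intros i.
  rewrite blk_cut; blk_cases (max (fst p) N) (snd p) i.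
  + apply blk_in; lia.
  + destruct (classic (max (fst p) N <= i < max (snd p) N)%nat); [lia|now apply blk_out].
- intros p _; do 2 f_equal; apply functional_extensionality; intros i.
  blk_cases (fst p) (snd p) i; blk_cases 0%nat N i; (apply blk_in; lia) || (apply blk_out; lia).
Qed.

(** Below [N], the vectors w - a and w - b cannot both have r-th power at most B/2^r, or a - b would
    have at most [B]. One of them thus spends B/2^r on its head, and beyond [N] both coincide with
    [w]. The case B <= 0 covers a vanishing slope. *)
Lemma NPr_midpoint (s r A B : R) (N : nat) (a b w : rseq) :
  1 <= s -> 1 <= r ->
  (forall n, (N <= n)%nat -> a n = 0) -> (forall n, (N <= n)%nat -> b n = 0) ->
  NPr s r A (rsub w a) -> NPr s r A (rsub w b) ->
  B <= 0 \/ ~ NPr s r B (rsub a b) ->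
  NPr s r (A - Rmax B 0 / rpow 2 r) (cut N w).
Proof.
intros Hs Hr Ha Hb HA1 HA2 HB.
assert (H2 : 0 < rpow 2 r) by (apply rpow_gt0; lra).
assert (Ht : forall c d, (forall n, (N <= n)%nat -> c n = 0) ->
   NPr s r d (cut N (rsub w c)) -> NPr s r d (cut N w)).
{ intros c d Hc Hd; apply NPr_mono with d (cut N (rsub w c)); try easy; try lra.
  intros n; destruct (le_lt_dec N n).
  - rewrite !cut_ge by easy; unfold rsub; rewrite Hc, Rminus_0_r by easy; lra.
  - rewrite !cut_lt by easy; lra. }
destruct (Rle_lt_dec B 0) as [HB0|HB0].
- rewrite Rmax_right by easy; apply (Ht a); [easy|].
  apply NPr_mono with A (rsub w a); try easy; try lra.
  intros n; destruct (le_lt_dec N n).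
  + rewrite cut_ge by easy; lra.
  + rewrite cut_lt, Rabs_R0 by easy; apply Rabs_pos.
- rewrite Rmax_left by lra; destruct HB as [HB|HB]; [lra|].
  set (B' := B / rpow 2 r); assert (HB' : 0 < B') by now apply Rdiv_lt_0_compat.
  destruct (classic (NPr s r B' (blk 0 N (rsub w a)))) as [Hwa|Hwa].
  + apply (Ht b); [easy|]; apply NPr_split; try easy; try lra; intros Hwb.
    apply HB; replace B with (rpow 2 r * B') by (unfold B'; field; lra).
    apply NPr_double with (blk 0 N (rsub w a)) (blk 0 N (rsub w b)); try easy.
    intros n; blk_cases 0%nat N n; unfold rsub.
    * replace (a n - b n) with (- (w n - a n) + (w n - b n)) by ring.
      rewrite <- (Rabs_Ropp (w n - a n)); apply Rabs_triang.
    * rewrite Ha, Hb by lia; rewrite Rminus_0_r, Rabs_R0; lra.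
  + apply (Ht a); [easy|]; apply NPr_split; [easy|lra|easy|easy].
Qed.

(** * Ultralimits and concentration *)

Record free_ultrafilter (U : (nat -> Prop) -> Prop) : Prop := {
  ultra_tail : forall N, U (fun n => (N <= n)%nat);
  ultra_weaken : forall A B : nat -> Prop, (forall n, A n -> B n) -> U A -> U B;
  ultra_and : forall A B : nat -> Prop, U A -> U B -> U (fun n => A n /\ B n);
  ultra_inhabited : forall A : nat -> Prop, U A -> exists n, A n;
  ultra_em : forall A : nat -> Prop, U A \/ U (fun n => ~ A n)
}.

Lemma free_ultrafilter_exists : exists U, free_ultrafilter U.
Proof.
destruct (@filter.ultraFilterLemma nat filter.eventually _) as (U & HU & Hsub).
assert (HP := @filter.ultra_proper _ _ HU).
exists U; constructor.
- intros N; apply Hsub; exists N; [easy|]; intros n Hn.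
  exact (ssrbool.elimT (@ssrnat.leP N n) Hn).
- intros A B HAB HA; now apply (@filter.filterS _ U _ A B).
- intros A B HA HB; exact (@filter.filterI _ U _ A B HA HB).
- intros A HA; exact (@filter.filter_ex _ U HP A HA).
- intros A; exact (@filter.in_ultra_setVsetC _ U A HU).
Qed.

Section Ultralimits.

Variable U : (nat -> Prop) -> Prop.
Hypothesis HU : free_ultrafilter U.

Lemma ultra_all (A : nat -> Prop) : (forall n, A n) -> U A.
Proof.
intros H; apply (ultra_weaken U HU (fun n => (0 <= n)%nat)); [auto|apply ultra_tail, HU].
Qed.

(** Along an ultrafilter every bounded sequence converges, so iterated limits over k-tuples require
    no extraction of subsequences. *)
Definition ulim (phi : nat -> R) : R :=
  epsilon (inhabits 0) (fun x => forall eps, 0 < eps -> U (fun n => Rabs (phi n - x) < eps)).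

Lemma ulim_spec (phi : nat -> R) (C eps : R) :
  (forall n, Rabs (phi n) <= C) -> 0 < eps -> U (fun n => Rabs (phi n - ulim phi) < eps).
Proof.
intros HC; revert eps; unfold ulim; apply epsilon_spec.
destruct (completeness (fun y => U (fun n => y <= phi n))) as [x [Hx1 Hx2]].
- exists C; intros y Hy; destruct (ultra_inhabited U HU _ Hy) as [n Hn].
  apply Rle_trans with (1 := Hn), Rle_trans with (2 := HC n), Rle_abs.
- exists (- C); apply ultra_all; intros n; specialize (HC n).
  pose proof (Rle_abs (- phi n)) as H; rewrite Rabs_Ropp in H; lra.
- exists x; intros eps He.
  assert (H1 : U (fun n => x - eps < phi n)).
  { apply NNPP; intros Hn.
    assert (x <= x - eps); [|lra].
    apply Hx2; intros y Hy; apply Rnot_lt_le; intros Hlt; apply Hn.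
    apply (ultra_weaken U HU) with (2 := Hy); intros n Hle; lra. }
  assert (H2 : U (fun n => phi n < x + eps)).
  { destruct (ultra_em U HU (fun n => phi n < x + eps)) as [|H]; [easy|].
    assert (x + eps <= x); [|lra].
    apply Hx1; apply (ultra_weaken U HU) with (2 := H); intros n Hn; lra. }
  apply (ultra_weaken U HU) with (2 := ultra_and U HU _ _ H1 H2).
  intros n [Ha Hb]; apply Rabs_def1; lra.
Qed.

Lemma ulim_bound (phi : nat -> R) (C : R) :
  (forall n, Rabs (phi n) <= C) -> Rabs (ulim phi) <= C.
Proof.
intros HC; apply le_epsilon; intros e He.
destruct (ultra_inhabited U HU _ (ulim_spec phi C e HC He)) as [n Hn].
specialize (HC n); rewrite Rabs_minus_sym in Hn.
pose proof (Rabs_triang (ulim phi - phi n) (phi n)) as H.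
replace (ulim phi - phi n + phi n) with (ulim phi) in H by ring; lra.
Qed.

(** Membership in the k-fold Fubini product of [U]: each entry may be taken far beyond a threshold
    depending on the entries before it. *)
Fixpoint allU (k : nat) (P : list nat -> Prop) : Prop :=
  match k with
  | O => P []
  | S k' => U (fun n => allU k' (fun m => P (n :: m)))
  end.

Lemma allU_weaken (k : nat) : forall P Q : list nat -> Prop,
  (forall m, length m = k -> P m -> Q m) -> allU k P -> allU k Q.
Proof.
induction k as [|k IH]; simpl; intros P Q H HP; [now apply H|].
apply (ultra_weaken U HU) with (2 := HP); intros n; apply IH.
intros m Hm; apply H; simpl; now rewrite Hm.
Qed.

Lemma allU_all (k : nat) : forall P : list nat -> Prop,
  (forall m, length m = k -> P m) -> allU k P.
Proof.
induction k as [|k IH]; simpl; intros P H; [now apply H|].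
apply ultra_all; intros n; apply IH; intros m Hm; apply H; simpl; now rewrite Hm.
Qed.

Lemma allU_and (k : nat) : forall P Q : list nat -> Prop,
  allU k P -> allU k Q -> allU k (fun m => P m /\ Q m).
Proof.
induction k as [|k IH]; simpl; intros P Q HP HQ; [easy|].
apply (ultra_weaken U HU) with (2 := ultra_and U HU _ _ HP HQ).
intros n [H1 H2]; now apply IH.
Qed.

Lemma allU_inhabited (k : nat) : forall P : list nat -> Prop,
  allU k P -> exists m, length m = k /\ P m.
Proof.
induction k as [|k IH]; simpl; intros P HP; [now exists []|].
destruct (ultra_inhabited U HU _ HP) as [n Hn].
destruct (IH _ Hn) as (m & Hm & H); exists (n :: m); simpl; auto.
Qed.

Lemma allU_finite (k N : nat) (P : nat -> list nat -> Prop) :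
  (forall j, (j < N)%nat -> allU k (P j)) ->
  allU k (fun m => forall j, (j < N)%nat -> P j m).
Proof.
induction N as [|N IH]; intros H; [apply allU_all; intros; lia|].
apply allU_weaken with (2 := allU_and _ _ _ (IH (fun j Hj => H j ltac:(lia))) (H N ltac:(lia))).
intros m _ [H1 H2] j Hj; destruct (Nat.eq_dec j N) as [->|]; [easy|apply H1; lia].
Qed.

Lemma allU_differs (k : nat) : forall m0 : list nat,
  allU k (fun m => forall i, (i < k)%nat -> nth i m 0%nat <> nth i m0 0%nat).
Proof.
induction k as [|k IH]; simpl; intros m0; [intros; lia|].
apply (ultra_weaken U HU) with (2 := ultra_tail U HU (S (nth 0 m0 0%nat))).
intros n Hn; apply allU_weaken with (2 := IH (tl m0)).
intros m _ H [|i] Hi; [lia|].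
specialize (H i ltac:(lia)); destruct m0; simpl in *; [|easy].
now destruct i.
Qed.

Fixpoint il (k : nat) (phi : list nat -> R) : R :=
  match k with
  | O => phi []
  | S k' => ulim (fun n => il k' (fun m => phi (n :: m)))
  end.

Lemma il_bound (C : R) (k : nat) : forall phi : list nat -> R,
  (forall m, length m = k -> Rabs (phi m) <= C) -> Rabs (il k phi) <= C.
Proof.
induction k as [|k IH]; simpl; intros phi H; [now apply H|].
apply ulim_bound; intros n; apply IH; intros m Hm; apply H; simpl; now rewrite Hm.
Qed.

Lemma allU_il (C : R) (k : nat) : forall (phi : list nat -> R) (eps : R),
  (forall m, length m = k -> Rabs (phi m) <= C) -> 0 < eps ->
  allU k (fun m => Rabs (phi m - il k phi) < eps).
Proof.
induction k as [|k IH]; simpl; intros phi eps H He.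
- now rewrite Rminus_diag, Rabs_R0.
- assert (H' : forall n m, length m = k -> Rabs (phi (n :: m)) <= C)
    by (intros n m Hm; apply H; simpl; now rewrite Hm).
  assert (Hu := ulim_spec (fun n => il k (fun m => phi (n :: m))) C (eps / 2)
    (fun n => il_bound C k _ (H' n)) ltac:(lra)).
  apply (ultra_weaken U HU) with (2 := Hu); intros n Hn.
  apply allU_weaken with (2 := IH (fun m => phi (n :: m)) (eps / 2) (H' n) ltac:(lra)).
  intros m _ Hm; simpl in Hm.
  set (a := il k (fun m => phi (n :: m))) in *; set (b := ulim _) in *.
  replace (phi (n :: m) - b) with ((phi (n :: m) - a) + (a - b)) by ring.
  apply Rle_lt_trans with (1 := Rabs_triang _ _); lra.
Qed.

(** The coordinatewise limit plays the role of an iterated weak-star limit; it need not have finite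
    support. *)
Definition ilv (k : nat) (h : list nat -> rseq) : rseq := fun j => il k (fun m => h m j).

Lemma allU_ilv (k N : nat) (C eta : R) (h : list nat -> rseq) :
  (forall m j, length m = k -> Rabs (h m j) <= C) -> 0 < eta ->
  allU k (fun m => forall j, (j < N)%nat -> Rabs (h m j - ilv k h j) < eta).
Proof.
intros H He; apply allU_finite; intros j _; apply (allU_il C); [|easy].
intros m Hm; now apply H.
Qed.

End Ultralimits.

Lemma NB_head_small (s eta : R) (N : nat) (x : rseq) :
  1 <= s -> 0 <= eta -> (forall j, (j < N)%nat -> Rabs (x j) <= eta) ->
  NB s (blk 0 N x) (INR N * eta).
Proof.
intros Hs He H; apply NB_finsupp; [easy|apply finsupp_blk|].
apply ns_small; [easy|easy|intros n Hn; apply blk_out; lia|].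
intros n; blk_cases 0%nat N n; [apply H; lia|now rewrite Rabs_R0].
Qed.

Lemma INR_div_succ_le (N : nat) (eta : R) : 0 <= eta -> INR N * (eta / (INR N + 1)) <= eta.
Proof.
intros He; pose proof (pos_INR N).
replace (INR N * (eta / (INR N + 1))) with (eta * (INR N / (INR N + 1))) by (field; lra).
rewrite <- (Rmult_1_r eta) at 2; apply Rmult_le_compat_l; [easy|].
apply Rmult_le_reg_r with (INR N + 1); [lra|].
unfold Rdiv; rewrite Rmult_assoc, Rinv_l; lra.
Qed.

Lemma INR_div_succ_pos (N : nat) (eta : R) : 0 < eta -> 0 < eta / (INR N + 1).
Proof. intros He; pose proof (pos_INR N); apply Rdiv_lt_0_compat; lra. Qed.

(** Each partial norm sees only [N] coordinates, and closeness e/(N+1) on these costs at most [e].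
    The denominator N+1 also covers N = 0. *)
Lemma NB_closure (s c : R) (x : rseq) :
  1 <= s ->
  (forall N eta, 0 < eta -> exists y, NB s y c /\
     forall j, (j < N)%nat -> Rabs (x j - y j) <= eta) ->
  NB s x c.
Proof.
intros Hs H N; apply le_epsilon; intros e He.
destruct (H N (e / (INR N + 1)) (INR_div_succ_pos N e He)) as (y & Hy & Hxy).
assert (Hd : NB s (blk 0 N (rsub x y)) e).
{ eapply NB_le; [apply NB_head_small; [easy|apply Rlt_le, INR_div_succ_pos, He|apply Hxy]|].
  apply INR_div_succ_le; lra. }
assert (Hx : NB s (blk 0 N x) (c + e)).
{ apply NB_triangle with y (blk 0 N (rsub x y)); try easy.
  intros n; blk_cases 0%nat N n.
  - unfold rsub; replace (x n) with (y n + (x n - y n)) at 1 by ring; apply Rabs_triang.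
  - rewrite Rabs_R0; pose proof (Rabs_pos (y n)); lra. }
apply NB_finsupp in Hx; [easy|easy|apply finsupp_blk].
Qed.

Section Concentration.

Variable U : (nat -> Prop) -> Prop.
Hypothesis HU : free_ultrafilter U.
Variables l lam : R.
Hypothesis Hl : 1 <= l.
Hypothesis Hlam : 0 < lam.

(* The increments along the iterated limits are almost disjoint blocks of norm at
   most [lam], so they add up like an l_l sum. *)
Lemma concentration (C : R) (k : nat) : forall h : list nat -> rseq,
  (forall m, length m = k -> NB l (h m) C) ->
  (forall a x y b, length (a ++ x :: b) = k ->
     NB l (rsub (h (a ++ x :: b)) (h (a ++ y :: b))) lam) ->
  forall c, 0 <= c -> INR k * rpow lam l < rpow c l ->
  allU U k (fun m => NB l (rsub (h m) (ilv U k h)) c).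
Proof.
induction k as [|k IH]; intros h HC Hstep c Hc Hck.
{ simpl; intros n; unfold ilv; simpl.
  replace (blk 0 n (rsub (h []) (fun j => h [] j))) with (fun _ : nat => 0);
    [now rewrite ns_zero|].
  apply functional_extensionality; intros i; unfold rsub; blk_cases 0%nat n i; ring || easy. }
simpl; apply (ultra_all U HU); intros n.
set (hn := fun m => h (n :: m)); set (un := ilv U k hn); set (u := ilv U (S k) h).
assert (HCn : forall m, length m = k -> NB l (hn m) C)
  by (intros m Hm; apply HC; simpl; now rewrite Hm).
assert (Habs : forall m j, length m = S k -> Rabs (h m j) <= C)
  by (intros m j Hm; apply (NB_abs l); auto).
assert (Habsn : forall m j, length m = k -> Rabs (hn m j) <= C)
  by (intros m j Hm; apply (NB_abs l); auto).
(* Fixing or freeing the first entry changes the limit by at most [lam]: both limits are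
   approximated on finitely many coordinates by tuples with a common remainder [m] and first entries
   [n] and n'. *)
assert (Hun : NB l (rsub un u) lam).
{ apply NB_closure; [easy|]; intros N eta He.
  assert (H1 := allU_ilv U HU (S k) N C (eta / 2) h Habs ltac:(lra)).
  simpl in H1; destruct (ultra_inhabited U HU _ H1) as [n' Hn'].
  assert (H2 := allU_ilv U HU k N C (eta / 2) hn Habsn ltac:(lra)).
  destruct (allU_inhabited U HU _ _ (allU_and U HU _ _ _ Hn' H2)) as (m & Hm & Ha & Hb).
  exists (rsub (h (n :: m)) (h (n' :: m))); split.
  - apply (Hstep [] n n' m); simpl; now rewrite Hm.
  - intros j Hj; specialize (Ha j Hj); specialize (Hb j Hj).
    fold u in Ha; fold un in Hb; unfold hn in Hb; unfold rsub.
    replace (un j - u j - (h (n :: m) j - h (n' :: m) j))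
      with (- (h (n :: m) j - un j) + (h (n' :: m) j - u j)) by ring.
    apply Rle_trans with (1 := Rabs_triang _ _); rewrite Rabs_Ropp; lra. }
rewrite S_INR in Hck; pose proof (pos_INR k) as Hk.
assert (Hll := rpow_gt0 lam l Hlam).
(* The strict inequality leaves the slack [d]. Half of it goes to the induction hypothesis through
   [c1], so that c2^l = lam^l + c1^l is still below c^l; the rest, c - c2 = 2 eta, pays for two
   overlaps. *)
set (d := rpow c l - (INR k + 1) * rpow lam l).
assert (Hd : 0 < d) by (unfold d; lra).
set (c1 := rpow (INR k * rpow lam l + d / 2) (1 / l)).
assert (E1 : rpow c1 l = INR k * rpow lam l + d / 2) by (apply rpow_inv_rpow; nra).
set (c2 := rpow ((INR k + 1) * rpow lam l + d / 2) (1 / l)).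
assert (E2 : rpow c2 l = (INR k + 1) * rpow lam l + d / 2) by (apply rpow_inv_rpow; nra).
assert (Hc2 : c2 < c).
{ apply Rnot_le_lt; intros H; apply (rpow_le _ _ l) in H; [|lra]; unfold d in *; lra. }
set (eta := (c - c2) / 2); assert (He : 0 < eta) by (unfold eta; lra).
(* At this [N] the increments become almost disjoint: un - u is small beyond it, and for most [m]
   the vector hn m - un is small before it. *)
destruct (NB_tail_small l lam eta _ Hl Hun He) as [N HN].
assert (H1 : allU U k (fun m => NB l (rsub (hn m) un) c1)).
{ apply IH; [easy| |apply rpow_ge0|lra].
  intros a x y b Hlen; apply (Hstep (n :: a) x y b); simpl; now rewrite Hlen. }
assert (H2 := allU_ilv U HU k N C (eta / (INR N + 1)) hn Habsn (INR_div_succ_pos N eta He)).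
apply (allU_weaken U HU) with (2 := allU_and U HU _ _ _ H1 H2).
intros m Hm [Hm1 Hm2]; fold un in Hm2.
assert (Hy1 : NB l (fun j => if Nat.ltb j N then un j - u j else hn m j - un j) c2).
{ apply NB_disjoint with lam c1 (rsub un u) (rsub (hn m) un); try easy.
  - apply rpow_ge0.
  - intros j; unfold rsub; destruct (Nat.ltb j N); [left|right]; lra.
  - lra. }
assert (Hy3 : NB l (blk 0 N (rsub (hn m) un)) eta).
{ eapply NB_le; [apply NB_head_small|apply INR_div_succ_le; lra]; try easy.
  - apply Rlt_le, INR_div_succ_pos, He.
  - intros j Hj; apply Rlt_le, Hm2, Hj. }
replace c with (c2 + (eta + eta)) by (unfold eta; field).
apply NB_triangle with (1 := Hl) (2 := Hy1)
  (y := fun j => if Nat.ltb j N then hn m j - un j else un j - u j).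
- apply NB_triangle with (1 := Hl) (2 := Hy3) (3 := HN).
  intros j; destruct (Nat.ltb_spec j N).
  + rewrite blk_in, cut_lt, Rabs_R0 by lia; unfold rsub; lra.
  + rewrite blk_out, cut_ge, Rabs_R0 by lia; unfold rsub; lra.
- intros j; unfold rsub; fold hn; change (h (n :: m) j) with (hn m j).
  destruct (Nat.ltb j N).
  + replace (hn m j - u j) with ((un j - u j) + (hn m j - un j)) by ring; apply Rabs_triang.
  + replace (hn m j - u j) with ((hn m j - un j) + (un j - u j)) by ring; apply Rabs_triang.
Qed.

End Concentration.

(** * Approximate midpoints *)

(** The norm of a sum of [k] unit vectors in l_s, and in T^s up to a factor 4 by [ns_le_support] and
    [ns_ge_support]. *)
Definition root (k : nat) (s : R) : R := rpow (INR k) (1 / s).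

(* The domain contains, at every scale [t], large sets of approximate midpoints,
   parametrised by k-tuples; [near t] is "distance at most t" for an auxiliary
   metric, which for p > q is not the metric [d] of the domain. *)
Definition midpoint_families {X : Type} (d : X -> X -> R) (D : X -> Prop)
    (s l : R) (k : nat) : Prop :=
  exists near : R -> X -> X -> Prop,
    (exists x0, forall t, 0 < t -> near t x0 x0) /\
    (forall t x y, near t x y -> D x /\ D y /\ d x y <= root k s * t) /\
    (forall t sigma x y, 0 < t -> 0 < sigma -> near t x y ->
       exists W : list nat -> X,
         (forall m, length m = k ->
            let t' := t / 2 * rpow (1 + rpow (2 * root k s * sigma) l) (1 / l) in
            near t' (W m) x /\ near t' (W m) y) /\
         (forall a i j b, length (a ++ i :: b) = k ->
            d (W (a ++ i :: b)) (W (a ++ j :: b)) <= 2 * sigma * t) /\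
         (forall m m', length m = k -> length m' = k ->
            (forall i, (i < k)%nat -> nth i m 0%nat <> nth i m' 0%nat) ->
            root k s * sigma * t / 4 <= d (W m) (W m'))).

Lemma exists_inf (P : R -> Prop) (mu0 : R) :
  P mu0 -> (forall mu, P mu -> 0 <= mu) ->
  exists M, 0 <= M <= mu0 /\
    forall eps, 0 < eps -> (exists mu, P mu /\ mu < M + eps) /\ ~ P (M - eps).
Proof.
intros H0 Hpos; destruct (completeness (fun y => P (- y))) as [y [Hy1 Hy2]].
- exists 0; intros y Hy; apply Hpos in Hy; lra.
- exists (- mu0); now rewrite Ropp_involutive.
- exists (- y); repeat split.
  + enough (y <= 0) by lra; apply Hy2; intros z Hz; apply Hpos in Hz; lra.
  + enough (- mu0 <= y) by lra; apply Hy1; now rewrite Ropp_involutive.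
  + apply NNPP; intros Hn; assert (y <= y - eps); [|lra].
    apply Hy2; intros z Hz; apply Rnot_lt_le; intros Hlt; apply Hn.
    exists (- z); split; [easy|lra].
  + intros HP; assert (y + eps <= y); [|lra].
    apply Hy1; now replace (- (y + eps)) with (- y - eps) by ring.
Qed.

Lemma exists_root_ratio (s l B : R) :
  1 <= s -> s < l -> 0 < B -> exists k, (1 <= k)%nat /\ B * root k l <= root k s.
Proof.
intros Hs Hl HB; set (e := 1 / s - 1 / l).
assert (He : 0 < e).
{ unfold e, Rdiv; rewrite !Rmult_1_l.
  assert (/ l < / s) by (apply Rinv_lt_contravar; [apply Rmult_lt_0_compat|]; lra); lra. }
destruct (INR_archimed 1 (rpow B (1 / e)) ltac:(lra)) as [k Hk].
rewrite Rmult_1_r in Hk; assert (Hk1 : (1 <= k)%nat).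
{ destruct k; [simpl in Hk; pose proof (rpow_ge0 B (1 / e)); lra|lia]. }
exists k; split; [easy|]; unfold root.
replace (1 / s) with (e + 1 / l) by (unfold e; ring).
rewrite rpow_plus_r; apply Rmult_le_compat_r; [apply rpow_ge0|].
apply rpow_le_of_inv; lra.
Qed.

Section Core.

Variables (X : Type) (d : X -> X -> R) (D : X -> Prop) (g h : X -> rseq) (s l L : R).
Hypothesis Hs : 1 <= s.
Hypothesis Hsl : s < l.
Hypothesis HL : 0 < L.
Hypothesis g_finsupp : forall x, D x -> finsupp (g x).
Hypothesis h_bounded : forall x, D x -> exists C, NB l (h x) C.
Hypothesis g_upper : forall x y, D x -> D y -> NB s (rsub (g x) (g y)) (L * d x y + L).
Hypothesis h_upper : forall x y, D x -> D y -> NB l (rsub (h x) (h y)) (L * d x y + L).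
Hypothesis gh_lower : forall x y a b, D x -> D y ->
  NB s (rsub (g x) (g y)) a -> NB l (rsub (h x) (h y)) b -> d x y / L - L <= a + b.

(* [mu] is an r-th power, so that midpoints are compared without roots. *)
Definition slope (near : R -> X -> X -> Prop) (r mu : R) : Prop :=
  0 <= mu /\ exists t0, forall t x y, t0 <= t -> near t x y ->
    NPr s r (mu * rpow t r) (rsub (g x) (g y)).

Lemma slope_exists (near : R -> X -> X -> Prop) (r K : R) :
  s < r -> 0 < K ->
  (forall t x y, near t x y -> D x /\ D y /\ d x y <= K * t) ->
  exists mu, slope near r mu.
Proof.
intros Hr HK Hnear; destruct (NB_NPr s r Hs Hr) as (Z & HZ & H).
exists (Z * rpow (L * K + L) r); split.
- apply Rmult_le_pos; [lra|apply rpow_ge0].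
- exists 1; intros t x y Ht Hxy; destruct (Hnear t x y Hxy) as (Dx & Dy & Hd).
  rewrite Rmult_assoc, <- rpow_mult by nra; apply H.
  apply NB_le with (1 := g_upper x y Dx Dy).
  apply (Rmult_le_compat_l L) in Hd; [|lra]; nra.
Qed.

(** Since r < l, t'^r <= (t/2)^r (1+x). By [NPr_midpoint] the tail costs at most (t/2)^r
    ((M+eps)(1+x) - (M-eps)) = (t/2)^r (M x + eps (2+x)), which the smallness hypothesis turns into
    (theta sigma t)^r. *)
Lemma midpoint_gap (r K theta sigma M mu eps t : R) (N : nat) (a b w : rseq) :
  s < r -> r < l -> 0 < t -> 0 < theta -> 0 < sigma -> 0 < K ->
  let x := rpow (2 * K * sigma) l in
  let t' := t / 2 * rpow (1 + x) (1 / l) in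
  0 <= M -> 0 < eps -> 0 <= mu -> mu < M + eps ->
  M * x + eps * (2 + x) <= rpow (2 * theta * sigma) r ->
  (forall n, (N <= n)%nat -> a n = 0) -> (forall n, (N <= n)%nat -> b n = 0) ->
  NPr s r (mu * rpow t' r) (rsub w a) -> NPr s r (mu * rpow t' r) (rsub w b) ->
  (M - eps) * rpow t r <= 0 \/ ~ NPr s r ((M - eps) * rpow t r) (rsub a b) ->
  NB s (cut N w) (theta * sigma * t).
Proof.
intros Hsr Hrl Ht Hth Hsg HK x t' HM Heps Hmu HmuM Hsmall Ha Hb Hwa Hwb HB.
assert (Hx : 0 <= x) by apply rpow_ge0.
assert (Hts : 0 < theta * sigma) by now apply Rmult_lt_0_compat.
assert (H2 : 0 < rpow 2 r) by (apply rpow_gt0; lra).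
assert (Htr : 0 < rpow t r) by now apply rpow_gt0.
apply NPr_NB with r; [lra|nra|].
apply NPr_mono with (mu * rpow t' r - Rmax ((M - eps) * rpow t r) 0 / rpow 2 r) (cut N w);
  [lra|lra| | |intros; lra].
- apply NPr_midpoint with a b; try easy; lra.
- assert (Et : rpow (t / 2) r = rpow t r / rpow 2 r).
  { replace (rpow t r) with (rpow (t / 2) r * rpow 2 r); [field; lra|].
    rewrite <- rpow_mult by lra; f_equal; field. }
  assert (Ht' : rpow t' r <= rpow t r / rpow 2 r * (1 + x)).
  { unfold t'; rewrite rpow_mult, Et by (lra || apply rpow_ge0).
    apply Rmult_le_compat_l; [apply Rlt_le, Rdiv_lt_0_compat; lra|].
    rewrite rpow_rpow, <- (rpow_1_r (1 + x)) at 1 by lra.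
    rewrite <- (rpow_1_r (1 + x)) at 2 by lra.
    rewrite rpow_rpow; apply rpow_le_exponent; [lra|].
    apply Rmult_le_reg_r with l; [lra|].
    replace (1 * (1 / l * r) * l) with r by (field; lra); lra. }
  assert (Emax := Rmax_l ((M - eps) * rpow t r) 0).
  set (q := rpow t r / rpow 2 r) in *.
  assert (Hq : 0 < q) by (apply Rdiv_lt_0_compat; lra).
  assert (Hm : (M - eps) * q <= Rmax ((M - eps) * rpow t r) 0 / rpow 2 r).
  { unfold q; replace ((M - eps) * (rpow t r / rpow 2 r))
      with ((M - eps) * rpow t r / rpow 2 r) by (field; lra).
    apply Rmult_le_compat_r; [apply Rlt_le, Rinv_0_lt_compat|]; lra. }
  assert (HA : mu * rpow t' r <= (M + eps) * (q * (1 + x))).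
  { apply Rmult_le_compat; try lra; apply rpow_ge0. }
  replace (rpow (theta * sigma * t) r) with (q * rpow (2 * theta * sigma) r).
  + apply (Rmult_le_compat_l q) in Hsmall; [nra|lra].
  + unfold q; rewrite !Rmult_assoc, (rpow_mult 2), (rpow_mult theta), (rpow_mult theta),
      (rpow_mult sigma) by nra; field; lra.
Qed.

Lemma no_embedding_of_midpoint_families :
  (forall k, (1 <= k)%nat -> midpoint_families d D s l k) -> False.
Proof.
intros Hfam; set (r := (s + l) / 2).
assert (Hsr : s < r) by (unfold r; lra); assert (Hrl : r < l) by (unfold r; lra).
(* With lam <= 3 L sigma t this ratio makes 4 K' lam <= K sigma t / (16 L), as 4 * 3 * 16 = 192.
   Thus [h] contributes at most a quarter of the separation. *)
destruct (exists_root_ratio s l (192 * (L * L)) Hs Hsl ltac:(nra)) as (k & Hk & HKK).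
destruct (Hfam k Hk) as (near & [x0 Hx0] & Hnear & HW).
set (K := root k s) in *; set (K' := root k l) in *.
assert (Hk1 : 1 <= INR k) by (apply (le_INR 1); lia).
assert (HK' : 0 < K') by (apply rpow_gt0; lra).
assert (HK : 0 < K) by (apply rpow_gt0; lra).
destruct (slope_exists near r K Hsr HK Hnear) as [M0 HM0].
destruct (exists_inf (slope near r) M0 HM0 ltac:(intros mu [H _]; exact H))
  as (M & [HM HMM0] & HMinf).
set (theta := K / (32 * L)); assert (Hth : 0 < theta) by (apply Rdiv_lt_0_compat; lra).
(* Chosen so that sigma^(l-r) = q gives (M0+1)(2 K sigma)^l = (2 theta sigma)^r / 2; this is
   possible because r < l. The bound M0 + 1 dominates [M] and stays positive if the slope
   vanishes. *)
set (q := rpow (2 * theta) r / (2 * (M0 + 1) * rpow (2 * K) l)).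
assert (Hq : 0 < q).
{ apply Rdiv_lt_0_compat; [apply rpow_gt0; lra|].
  apply Rmult_lt_0_compat; [lra|apply rpow_gt0; lra]. }
set (sigma := rpow q (1 / (l - r))).
assert (Hsg : 0 < sigma) by now apply rpow_gt0.
set (x := rpow (2 * K * sigma) l).
assert (Hx : 0 <= x) by apply rpow_ge0.
assert (Ex : (M0 + 1) * x = rpow (2 * theta * sigma) r / 2).
{ unfold x; rewrite !(rpow_mult _ sigma) by nra.
  replace (rpow sigma l) with (rpow sigma r * q).
  - unfold q; field; split; [|lra].
    apply Rgt_not_eq, rpow_gt0; lra.
  - replace l with (r + (l - r)) by ring; rewrite rpow_plus_r; f_equal.
    symmetry; apply rpow_inv_rpow; lra. }
set (V := rpow (2 * theta * sigma) r) in *.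
assert (HV : 0 < V) by (apply rpow_gt0; nra).
(* The other half of [V] is left for the error in the slope. *)
set (eps := V / (2 * (2 + x))).
assert (Heps : 0 < eps) by (apply Rdiv_lt_0_compat; lra).
assert (Hsmall : M * x + eps * (2 + x) <= V).
{ replace (eps * (2 + x)) with (V / 2) by (unfold eps; field; lra). nra. }
destruct (HMinf eps Heps) as [(mu & [Hmu0 [t1 Ht1]] & Hmu) HnP].
(* The thresholds ensure, in turn, t' >= t/2 >= t1, where the slope [mu] is valid; t >= 1; sigma t
   >= 1, hence lam <= 3 L sigma t; and K sigma t / L >= 8 (L + 2) for the final contradiction. *)
set (T0 := Rmax (Rmax (2 * t1) 1) (Rmax (/ sigma) (8 * L * (L + 2) / (K * sigma)))).
(* M - eps is no slope, so beyond any threshold some pair almost attains [M]. If M <= eps, no lower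
   bound is needed and a constant pair serves. *)
assert (Hpick : exists t x y, T0 <= t /\ near t x y /\
  ((M - eps) * rpow t r <= 0 \/ ~ NPr s r ((M - eps) * rpow t r) (rsub (g x) (g y)))).
{ assert (HT0 : 0 < T0).
  { apply Rlt_le_trans with (2 := Rmax_l _ _), Rlt_le_trans with (2 := Rmax_r _ _); lra. }
  destruct (Rle_lt_dec (M - eps) 0) as [Hle|Hlt].
  - exists T0, x0, x0; repeat split; [lra|now apply Hx0|left].
    pose proof (rpow_ge0 T0 r); nra.
  - apply NNPP; intros Hn; apply HnP; split; [lra|].
    exists T0; intros t u v Ht Huv; apply NNPP; intros HN.
    apply Hn; exists t, u, v; auto. }
destruct Hpick as (t & u & v & Ht & Huv & HB).
assert (Ht_1 : 2 * t1 <= t)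
  by (apply Rle_trans with (2 := Ht), Rle_trans with (2 := Rmax_l _ _), Rmax_l).
assert (Ht_2 : 1 <= t)
  by (apply Rle_trans with (2 := Ht), Rle_trans with (2 := Rmax_l _ _), Rmax_r).
assert (Ht_3 : / sigma <= t)
  by (apply Rle_trans with (2 := Ht), Rle_trans with (2 := Rmax_r _ _), Rmax_l).
assert (Ht_4 : 8 * L * (L + 2) / (K * sigma) <= t)
  by (apply Rle_trans with (2 := Ht), Rle_trans with (2 := Rmax_r _ _), Rmax_r).
assert (Hst : 1 <= sigma * t).
{ apply (Rmult_le_compat_l sigma) in Ht_3; [|lra]; rewrite Rinv_r in Ht_3; lra. }
assert (HKst : 8 * L * (L + 2) <= K * sigma * t).
{ apply (Rmult_le_compat_l (K * sigma)) in Ht_4; [|nra].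
  replace (K * sigma * (8 * L * (L + 2) / (K * sigma))) with (8 * L * (L + 2)) in Ht_4
    by (field; lra); lra. }
destruct (HW t sigma u v ltac:(lra) Hsg Huv) as (W & Hmid & Hstep & Hsep).
fold K in Hmid; fold x in Hmid; cbv zeta in Hmid.
set (t' := t / 2 * rpow (1 + x) (1 / l)) in *.
assert (Ht' : t1 <= t').
{ assert (1 <= rpow (1 + x) (1 / l)).
  { apply rpow_ge1; [|lra]; apply Rlt_le, Rdiv_lt_0_compat; lra. }
  unfold t'; nra. }
destruct (Hnear t u v Huv) as (Du & Dv & _).
assert (DW : forall m, length m = k -> D (W m)).
{ intros m Hm; destruct (Hmid m Hm) as [H _]; now apply Hnear in H. }
destruct (g_finsupp u Du) as [N1 HN1]; destruct (g_finsupp v Dv) as [N2 HN2].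
set (N := max N1 N2).
assert (Hgap : forall m, length m = k -> NB s (cut N (g (W m))) (theta * sigma * t)).
{ intros m Hm; destruct (Hmid m Hm) as [H1 H2].
  apply (midpoint_gap r K theta sigma M mu eps t N (g u) (g v)); try easy; try lra.
  - intros n Hn; apply HN1; lia.
  - intros n Hn; apply HN2; lia.
  - now apply Ht1.
  - now apply Ht1. }
assert (Hgbd : exists C, forall m j, length m = k -> Rabs (g (W m) j) <= C).
{ exists (ns s (g u) + (L * (K * t') + L)); intros m j Hm.
  destruct (Hmid m Hm) as [H1 _]; apply Hnear in H1; destruct H1 as (_ & _ & Hd).
  apply (NB_abs s); [easy|].
  apply NB_triangle with (g u) (rsub (g (W m)) (g u)); [easy| | |].
  - apply NB_finsupp; [easy|now apply g_finsupp|lra].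
  - apply NB_le with (1 := g_upper _ _ (DW m Hm) Du).
    apply (Rmult_le_compat_l L) in Hd; lra.
  - intros n; unfold rsub; replace (g (W m) n) with (g u n + (g (W m) n - g u n)) at 1 by ring.
    apply Rabs_triang. }
destruct Hgbd as [Cg HCg].
assert (Hhbd : exists C, forall m, length m = k -> NB l (h (W m)) C).
{ destruct (h_bounded u Du) as [C HC].
  exists (C + (L * (K * t') + L)); intros m Hm.
  destruct (Hmid m Hm) as [H1 _]; apply Hnear in H1; destruct H1 as (_ & _ & Hd).
  apply NB_triangle with (h u) (rsub (h (W m)) (h u)); [lra|easy| |].
  - apply NB_le with (1 := h_upper _ _ (DW m Hm) Du).
    apply (Rmult_le_compat_l L) in Hd; lra.
  - intros n; unfold rsub; replace (h (W m) n) with (h u n + (h (W m) n - h u n)) at 1 by ring.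
    apply Rabs_triang. }
destruct Hhbd as [Ch HCh].
destruct free_ultrafilter_exists as [U HU].
set (lam := 2 * L * (sigma * t) + L).
assert (Hlam : 0 < lam) by (unfold lam; nra).
assert (Hconc : allU U k (fun m =>
  NB l (rsub (h (W m)) (ilv U k (fun m => h (W m)))) (2 * K' * lam))).
{ apply (concentration U HU l lam ltac:(lra) Hlam Ch); [easy| |nra|].
  - intros a i j b Hlen.
    assert (Hlen' : length (a ++ j :: b) = k) by (rewrite length_app in *; easy).
    apply NB_le with (1 := h_upper _ _ (DW _ Hlen) (DW _ Hlen')).
    specialize (Hstep a i j b Hlen); apply (Rmult_le_compat_l L) in Hstep; [|lra].
    unfold lam; lra.
  - rewrite !rpow_mult by lra; unfold K', root; rewrite rpow_inv_rpow by lra.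
    assert (1 < rpow 2 l) by (rewrite <- (rpow_1_l l); apply rpow_lt; lra).
    assert (0 < INR k * rpow lam l)
      by (apply Rmult_lt_0_compat; [lra|now apply rpow_gt0]).
    nra. }
(* The compact part: on the first [N] coordinates g (W m) is almost constant in [m], so two heads
   differ by at most 1 in norm. *)
assert (Hlim := allU_ilv U HU k N Cg (/ 2 / (INR N + 1)) (fun m => g (W m)) HCg
  (INR_div_succ_pos N (/ 2) ltac:(lra))).
assert (Hboth := allU_and U HU _ _ _ Hconc Hlim).
destruct (allU_inhabited U HU _ _ Hboth) as (m & Hm & Hmh & Hmg).
(* The second tuple is drawn after the first and avoids it in every entry, as the separation clause
   requires. *)
destruct (allU_inhabited U HU _ _ (allU_and U HU _ _ _ Hboth (allU_differs U HU k m)))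
  as (m' & Hm' & [Hmh' Hmg'] & Hdiff).
specialize (Hsep m' m Hm' Hm Hdiff).
assert (Hh : NB l (rsub (h (W m')) (h (W m))) (2 * K' * lam + 2 * K' * lam)).
{ apply NB_triangle with (2 := Hmh') (3 := Hmh); [lra|]; intros n; unfold rsub.
  set (z := ilv U k (fun m => h (W m)) n).
  replace (h (W m') n - h (W m) n) with ((h (W m') n - z) + - (h (W m) n - z)) by ring.
  rewrite <- (Rabs_Ropp (h (W m) n - z)); apply Rabs_triang. }
assert (Hhead : NB s (blk 0 N (rsub (g (W m')) (g (W m)))) 1).
{ eapply NB_le; [apply (NB_head_small s (1 / (INR N + 1)))|apply INR_div_succ_le; lra].
  - easy.
  - apply Rlt_le, INR_div_succ_pos; lra.
  - intros j Hj; specialize (Hmg j Hj); specialize (Hmg' j Hj); cbv beta in Hmg, Hmg'.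
    set (z := ilv U k (fun m => g (W m)) j) in *; unfold rsub.
    replace (g (W m') j - g (W m) j) with ((g (W m') j - z) + - (g (W m) j - z)) by ring.
    apply Rle_trans with (1 := Rabs_triang _ _); rewrite Rabs_Ropp.
    pose proof (pos_INR N).
    replace (1 / (INR N + 1)) with (/ 2 / (INR N + 1) + / 2 / (INR N + 1)) by (field; lra).
    lra. }
assert (Hg : NB s (rsub (g (W m')) (g (W m)))
  (1 + (theta * sigma * t + theta * sigma * t))).
{ apply NB_triangle with (2 := Hhead) (y := cut N (rsub (g (W m')) (g (W m)))); [easy| |].
  - apply NB_triangle with (2 := Hgap m' Hm') (3 := Hgap m Hm); [easy|].
    intros n; destruct (le_lt_dec N n).
    + rewrite !cut_ge by easy; unfold rsub, Rminus.
      rewrite <- (Rabs_Ropp (g (W m) n)); apply Rabs_triang.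
    + rewrite !cut_lt, Rabs_R0 by easy; lra.
  - intros n; blk_cases 0%nat N n.
    + rewrite cut_lt, Rabs_R0 by lia; lra.
    + rewrite cut_ge, Rabs_R0 by lia; lra. }
pose proof (gh_lower _ _ _ _ (DW m' Hm') (DW m Hm) Hg Hh) as Hlow.
assert (E1 : K * sigma * t / (4 * L) <= d (W m') (W m) / L).
{ replace (K * sigma * t / (4 * L)) with (K * sigma * t / 4 / L) by (field; lra).
  apply Rmult_le_compat_r; [apply Rlt_le, Rinv_0_lt_compat|]; lra. }
set (z := K * sigma * t / L).
assert (Ez : z * L = K * sigma * t) by (unfold z; field; lra).
assert (E2 : theta * sigma * t = z / 32) by (unfold z, theta; field; lra).
assert (E3 : K * sigma * t / (4 * L) = z / 4) by (unfold z; field; lra).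
assert (E4 : 4 * K' * lam <= z / 16).
{ apply Rmult_le_reg_r with L; [lra|].
  replace (z / 16 * L) with (K * sigma * t / 16) by (rewrite <- Ez; field).
  assert (Hl3 : lam <= 3 * L * (sigma * t)) by (unfold lam; nra).
  apply Rle_trans with (4 * K' * (3 * L * (sigma * t)) * L).
  - apply Rmult_le_compat_r; [lra|]; apply Rmult_le_compat_l; lra.
  - apply (Rmult_le_compat_r (sigma * t / 16)) in HKK; [|lra]. lra. }
assert (E5 : 8 * (L + 2) <= z).
{ apply Rmult_le_reg_r with L; [lra|]; rewrite Ez; lra. }
(* The separation z/4 faces 1 + L + z/16 + z/16, from the head of [g], the additive constant, the
   two tails of [g], and [h]. So z <= 8 (L + 1), against [E5]. *)
rewrite E2 in Hlow; rewrite E3 in E1; lra.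
Qed.

End Core.

(** * Finitely supported vectors *)

Lemma Tnorm00_single (a : nat) (x : rseq) :
  (forall n, n <> a -> x n = 0) -> Tnorm00 x <= Rabs (x a).
Proof.
intros H; apply (Tnorm00_le (fun z c => (forall n, n <> a -> z n = 0) /\ Rabs (z a) <= c)).
- clear; intros z c [Hz Hc]; split.
  + intros n; destruct (Nat.eq_dec n a) as [->|Hn]; [easy|].
    rewrite Hz, Rabs_R0 by easy; pose proof (Rabs_pos (z a)); lra.
  + intros Es HEs; exists (fun E => Rabs (restrict E z a)); split.
    * intros E _; split; [|lra]; intros n Hn; unfold restrict; rewrite Hz by easy.
      now destruct (in_dec Nat.eq_dec n E).
    * pose proof (admissible_sum_abs Es z a HEs); pose proof (Rabs_pos (z a)); lra.
- exists (S a); intros n Hn; apply H; lia.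
- split; [easy|lra].
Qed.

Lemma finsupp_of_list (A : list nat) (x : rseq) :
  (forall n, ~ In n A -> x n = 0) -> finsupp x.
Proof.
intros H; exists (S (list_max A)); intros n Hn; apply H; intros Hin.
assert (HF := proj1 (list_max_le A (list_max A)) (Nat.le_refl _)).
rewrite Forall_forall in HF; specialize (HF n Hin); lia.
Qed.

Lemma Tnorm00_le_support (A : list nat) : forall x : rseq,
  (forall n, ~ In n A -> x n = 0) -> Tnorm00 x <= lsum (fun a => Rabs (x a)) A.
Proof.
induction A as [|a A IH]; intros x Hx; simpl.
- replace x with (fun _ : nat => 0); [rewrite Tnorm00_zero; lra|].
  apply functional_extensionality; intros n; now rewrite Hx.
- set (x1 := fun n => if Nat.eq_dec n a then x n else 0).
  set (x2 := fun n => if Nat.eq_dec n a then 0 else x n).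
  assert (H1 : Tnorm00 x1 <= Rabs (x a)).
  { replace (x a) with (x1 a) by (unfold x1; now destruct (Nat.eq_dec a a)).
    apply Tnorm00_single; intros n Hn; unfold x1; now destruct (Nat.eq_dec n a). }
  assert (Hx2 : forall n, ~ In n A -> x2 n = 0).
  { intros n Hn; unfold x2; destruct (Nat.eq_dec n a); [easy|].
    apply Hx; simpl; intuition. }
  assert (H2 : lsum (fun a => Rabs (x2 a)) A <= lsum (fun a => Rabs (x a)) A).
  { apply lsum_le; intros n _; unfold x2; destruct (Nat.eq_dec n a); [|lra].
    rewrite Rabs_R0; apply Rabs_pos. }
  specialize (IH x2 Hx2).
  enough (Tnorm00 x <= 1 * Tnorm00 x1 + 1 * Tnorm00 x2) by lra.
  apply Tnorm00_combine; try lra.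
  + apply (finsupp_of_list [a]); intros n Hn; unfold x1; destruct (Nat.eq_dec n a); [|easy].
    exfalso; apply Hn; simpl; auto.
  + now apply (finsupp_of_list A).
  + intros n; unfold x1, x2; destruct (Nat.eq_dec n a); rewrite Rabs_R0; lra.
Qed.

Lemma ns_le_support (s c : R) (A : list nat) (x : rseq) :
  1 <= s -> 0 <= c -> (forall n, ~ In n A -> x n = 0) ->
  (forall n, Rabs (x n) <= c) -> ns s x <= root (length A) s * c.
Proof.
intros Hs Hc HA Hx; apply rpow_inv_le; [lra|apply Rmult_le_pos; [apply rpow_ge0|easy]|].
rewrite rpow_mult by (easy || apply rpow_ge0).
unfold root; rewrite rpow_inv_rpow by (lra || apply pos_INR).
eapply Rle_trans; [apply (Tnorm00_le_support A)|].
- intros n Hn; unfold pw; now rewrite HA, Rabs_R0, rpow_0.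
- rewrite <- lsum_const; apply lsum_le; intros a _; rewrite Rabs_pw.
  apply rpow_le; [lra|apply Hx].
Qed.

Lemma root_1 (s : R) : root 1 s = 1.
Proof. apply rpow_1_l. Qed.

Lemma root_ge1 (k : nat) (s : R) : 1 <= s -> (1 <= k)%nat -> 1 <= root k s.
Proof.
intros Hs Hk; apply rpow_ge1; [apply Rlt_le, Rdiv_lt_0_compat; lra|].
now apply (le_INR 1).
Qed.

Lemma root_2_le (s : R) : 1 <= s -> root 2 s <= 2.
Proof.
intros Hs; unfold root; replace (INR 2) with 2 by (simpl; ring).
rewrite <- (rpow_1_r 2) at 2 by lra; apply rpow_le_exponent; [lra|].
unfold Rdiv; rewrite Rmult_1_l, <- Rinv_1; apply Rinv_le_contravar; lra.
Qed.

Lemma chain_unit_intervals (n : nat) : forall lo,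
  chain lo (map (fun j => (j, S j)) (seq lo n)).
Proof. induction n as [|n IH]; intros lo; simpl; [easy|split; [lia|apply IH]]. Qed.

(** Each coordinate in [A] is a unit interval carrying at least c^s, and [Tnorm00_count] applies
    wherever [A] lies. Then (1/4)^s <= 1/4 passes to the root. *)
Lemma ns_ge_support (s c : R) (A : list nat) (x : rseq) :
  1 <= s -> 0 < c -> finsupp x -> NoDup A -> (forall a, In a A -> c <= Rabs (x a)) ->
  root (length A) s * c / 4 <= ns s x.
Proof.
intros Hs Hc Hx HA Hcx; apply (rpow_le_inv _ _ s); [lra|apply ns_ge0|].
rewrite rpow_ns by easy; assert (Hpx := finsupp_pw s x Hx).
assert (Hcs := rpow_gt0 c s Hc).
(* Filtering all unit intervals in increasing order yields a chain at once, so [A] need not be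
   sorted. *)
set (bl := filter (fun p => if Rle_dec (rpow c s) (Tnorm00 (blk (fst p) (snd p) (pw s x)))
  then true else false) (map (fun j => (j, S j)) (seq 0 (S (list_max A))))).
assert (Hcount : rpow c s * INR (length bl) <= 4 * Tnorm00 (pw s x)).
{ apply Tnorm00_count; [easy|easy|apply chain_filter, chain_unit_intervals|].
  intros p Hp; apply filter_In in Hp; destruct Hp as [_ Hp].
  now destruct (Rle_dec (rpow c s) (Tnorm00 (blk (fst p) (snd p) (pw s x)))). }
assert (Hlen : (length A <= length bl)%nat).
{ rewrite <- (length_map (fun j => (j, S j)) A); apply NoDup_incl_length.
  - apply FinFun.Injective_map_NoDup; [|easy]; intros i j E; now inversion E.
  - intros p Hp; apply in_map_iff in Hp; destruct Hp as (a & <- & Ha).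
    apply filter_In; split.
    + apply in_map_iff; exists a; split; [easy|]; apply in_seq.
      assert (HF := proj1 (list_max_le A (list_max A)) (Nat.le_refl _)).
      rewrite Forall_forall in HF; specialize (HF a Ha); lia.
    + simpl; destruct (Rle_dec (rpow c s) (Tnorm00 (blk a (S a) (pw s x)))) as [|Hn]; [easy|].
      exfalso; apply Hn; apply Rle_trans with (2 := Tnorm00_abs _ a (finsupp_blk _ _ _)).
      rewrite blk_in, Rabs_pw by lia; apply rpow_le; [lra|now apply Hcx]. }
apply le_INR in Hlen.
replace (root (length A) s * c / 4) with (root (length A) s * (c * / 4)) by field.
rewrite !rpow_mult by (lra || apply rpow_ge0).
unfold root; rewrite rpow_inv_rpow by (lra || apply pos_INR).
assert (H4 : rpow (/ 4) s <= / 4).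
{ replace (rpow (/ 4) s) with (/ rpow 4 s).
  - apply Rinv_le_contravar; [lra|]; rewrite <- (rpow_1_r 4) at 1 by lra.
    apply rpow_le_exponent; lra.
  - symmetry; apply Rmult_eq_reg_l with (rpow 4 s); [|apply Rgt_not_eq, rpow_gt0; lra].
    rewrite <- rpow_mult, !Rinv_r, rpow_1_l by (try apply Rgt_not_eq, rpow_gt0; lra); easy. }
pose proof (pos_INR (length A)).
apply Rle_trans with (INR (length A) * (rpow c s * / 4)).
- apply Rmult_le_compat_l; [easy|apply Rmult_le_compat_l; lra].
- nra.
Qed.

Definition finsupp2 (x : nat -> rseq) : Prop :=
  exists N, forall n i, (N <= n)%nat \/ (N <= i)%nat -> x n i = 0.

Definition sum_dist (p q : R) (x y : nat -> rseq) : R :=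
  ns q (fun n => ns p (rsub (x n) (y n))).

Lemma finsupp2_row (x : nat -> rseq) (n : nat) : finsupp2 x -> finsupp (x n).
Proof. intros [N HN]; exists N; auto. Qed.

Lemma finsupp_rsub (x y : rseq) : finsupp x -> finsupp y -> finsupp (rsub x y).
Proof.
intros [N HN] [M HM]; exists (max N M); intros n Hn; unfold rsub.
rewrite HN, HM by lia; ring.
Qed.

Lemma ns_eq0 (s : R) (x : rseq) : (forall n, x n = 0) -> ns s x = 0.
Proof.
intros H; replace x with (fun _ : nat => 0); [apply ns_zero|].
apply functional_extensionality; intros n; now rewrite H.
Qed.

Lemma finsupp_row_norms (p : R) (x y : nat -> rseq) :
  finsupp2 x -> finsupp2 y -> finsupp (fun n => ns p (rsub (x n) (y n))).
Proof.
intros [N HN] [M HM]; exists (max N M); intros n Hn; apply ns_eq0; intros i; unfold rsub.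
rewrite HN, HM by lia; ring.
Qed.

Lemma SumTpTq_dist_finsupp2 (p q : R) (x y : nat -> rseq) :
  1 <= p -> 1 <= q -> finsupp2 x -> finsupp2 y ->
  SumTpTq_dist p q x y = sum_dist p q x y.
Proof.
intros Hp Hq Hx Hy; unfold SumTpTq_dist, SumTpTq_norm, sum_dist.
replace (fun n => Trnorm p (rsub (x n) (y n))) with (fun n => ns p (rsub (x n) (y n))).
- now apply Trnorm_finsupp, finsupp_row_norms.
- apply functional_extensionality; intros n; symmetry; apply Trnorm_finsupp; [easy|].
  apply finsupp_rsub; now apply finsupp2_row.
Qed.

Lemma inSumTpTq_finsupp2 (p q : R) (x : nat -> rseq) :
  1 <= p -> finsupp2 x -> inSumTpTq p q x.
Proof.
intros Hp Hx; split.
- intros n; now apply inTr_finsupp, finsupp2_row.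
- apply inTr_finsupp; destruct Hx as [N HN]; exists N; intros n Hn.
  rewrite Trnorm_finsupp by (easy || (exists N; auto)); apply ns_eq0; auto.
Qed.

(** At coarse scale [G] may be truncated at an index depending arbitrarily on the point: dropping
    tails of norm at most 1 alters differences by at most 2, absorbed in passing from [L] to L + 4.
    The truncation supplies the finite supports needed for midpoints. *)
Lemma not_coarse_lipschitz_pair (s l L : R) (X : Type) (d : X -> X -> R) (D : X -> Prop)
    (G H : X -> rseq) :
  1 <= s -> s < l -> 0 < L -> (forall x y, 0 <= d x y) ->
  (forall x, D x -> inTr s (G x) /\ inTr l (H x)) ->
  (forall x y, D x -> D y ->
     Trnorm s (rsub (G x) (G y)) + Trnorm l (rsub (H x) (H y)) <= L * d x y + L) ->
  (forall x y, D x -> D y ->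
     d x y / L - L <= Trnorm s (rsub (G x) (G y)) + Trnorm l (rsub (H x) (H y))) ->
  (forall k, (1 <= k)%nat -> midpoint_families d D s l k) -> False.
Proof.
intros Hs Hsl HL Hd Hin Hup Hlo.
assert (Hl : 1 <= l) by lra.
set (trunc := fun x => epsilon (inhabits 0%nat) (fun N => NB s (cut N (G x)) 1)).
assert (Htr : forall x, D x -> NB s (cut (trunc x) (G x)) 1).
{ intros x Dx; unfold trunc; apply epsilon_spec; apply inTr_tail; [easy|now apply Hin]. }
set (g := fun x => blk 0 (trunc x) (G x)).
assert (Hdiff : forall r u v, 1 <= r -> inTr r u -> inTr r v -> exists C, NB r (rsub u v) C).
{ intros r u v Hr Hu Hv; destruct (inTr_NB r u Hr Hu) as [C1 H1].
  destruct (inTr_NB r v Hr Hv) as [C2 H2]; exists (C1 + C2).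
  apply NB_triangle with u v; try easy; intros n; unfold rsub, Rminus.
  rewrite <- (Rabs_Ropp (v n)); apply Rabs_triang. }
assert (HGH : forall x y, D x -> D y -> forall a b, 0 <= a -> 0 <= b ->
  (Trnorm s (rsub (G x) (G y)) <= a <-> NB s (rsub (G x) (G y)) a) /\
  (Trnorm l (rsub (H x) (H y)) <= b <-> NB l (rsub (H x) (H y)) b)).
{ intros x y Dx Dy a b Ha Hb; destruct (Hin x Dx) as [Gx Hx], (Hin y Dy) as [Gy Hy].
  destruct (Hdiff s _ _ Hs Gx Gy) as [C1 H1], (Hdiff l _ _ Hl Hx Hy) as [C2 H2].
  split; [now apply (Trnorm_le_iff s a C1)|now apply (Trnorm_le_iff l b C2)]. }
assert (Habs : forall x n, Rabs (G x n - g x n) <= Rabs (cut (trunc x) (G x) n)).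
{ intros x n; unfold g; blk_cases 0%nat (trunc x) n.
  - rewrite Rminus_diag, Rabs_R0; apply Rabs_pos.
  - rewrite cut_ge, Rminus_0_r by lia; lra. }
assert (Hcut : forall x y, D x -> D y ->
  NB s (fun n => (G x n - g x n) - (G y n - g y n)) (1 + 1)).
{ intros x y Dx Dy; apply NB_triangle with (1 := Hs) (2 := Htr x Dx) (3 := Htr y Dy).
  intros n; specialize (Habs x n) as H1; specialize (Habs y n) as H2.
  apply Rle_trans with (2 := Rplus_le_compat _ _ _ _ H1 H2); unfold Rminus at 1.
  rewrite <- (Rabs_Ropp (G y n - g y n)); apply Rabs_triang. }
apply (no_embedding_of_midpoint_families X d D g H s l (L + 4)); try lra.
- intros x _; apply finsupp_blk.
- intros x Dx; apply inTr_NB; [easy|now apply Hin].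
- intros x y Dx Dy; specialize (Hup x y Dx Dy); specialize (Hd x y).
  pose proof (rpow_ge0 (Tnorm (fun n => rpow (Rabs (rsub (H x) (H y) n)) l)) (1 / l)) as HT.
  fold (Trnorm l (rsub (H x) (H y))) in HT.
  assert (Hge : 0 <= L * d x y + L) by nra.
  assert (HG : NB s (rsub (G x) (G y)) (L * d x y + L))
    by (apply (HGH x y Dx Dy _ _ Hge Hge); lra).
  apply NB_le with (L * d x y + L + (1 + 1)); [|nra].
  apply NB_triangle with (1 := Hs) (2 := HG) (3 := Hcut x y Dx Dy).
  intros n; unfold rsub.
  replace (g x n - g y n) with ((G x n - G y n) + - (G x n - g x n - (G y n - g y n))) by ring.
  rewrite <- (Rabs_Ropp (G x n - g x n - (G y n - g y n))); apply Rabs_triang.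
- intros x y Dx Dy; specialize (Hup x y Dx Dy); specialize (Hd x y).
  pose proof (rpow_ge0 (Tnorm (fun n => rpow (Rabs (rsub (G x) (G y) n)) s)) (1 / s)) as HT.
  fold (Trnorm s (rsub (G x) (G y))) in HT.
  assert (Hge : 0 <= L * d x y + L) by nra.
  apply NB_le with (L * d x y + L); [|nra].
  apply (HGH x y Dx Dy _ _ Hge Hge); lra.
- intros x y a b Dx Dy Ha Hb; specialize (Hlo x y Dx Dy); specialize (Hd x y).
  assert (Ha0 := NB_ge0 _ _ _ Ha); assert (Hb0 := NB_ge0 _ _ _ Hb).
  assert (HG : NB s (rsub (G x) (G y)) (a + (1 + 1))).
  { apply NB_triangle with (1 := Hs) (2 := Ha) (3 := Hcut x y Dx Dy).
    intros n; unfold rsub.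
    replace (G x n - G y n) with ((g x n - g y n) + (G x n - g x n - (G y n - g y n))) by ring.
    apply Rabs_triang. }
  apply (HGH x y Dx Dy (a + (1 + 1)) b ltac:(lra) Hb0) in HG.
  apply (HGH x y Dx Dy (a + (1 + 1)) b ltac:(lra) Hb0) in Hb.
  assert (d x y / (L + 4) <= d x y / L).
  { apply Rmult_le_compat_l; [easy|]; apply Rinv_le_contravar; lra. }
  lra.
Qed.

(** * Midpoint families in the domain *)

Lemma nth_le_list_max (m : list nat) (i : nat) : (nth i m 0 <= list_max m)%nat.
Proof.
destruct (le_lt_dec (length m) i) as [H|H]; [rewrite nth_overflow; lia|].
assert (HF := proj1 (list_max_le m (list_max m)) (Nat.le_refl _)).
rewrite Forall_forall in HF; now apply HF, nth_In.
Qed.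

Lemma nth_app_cons_ne (a b : list nat) (i j e : nat) :
  e <> length a -> nth e (a ++ i :: b) 0%nat = nth e (a ++ j :: b) 0%nat.
Proof.
intros He; destruct (lt_dec e (length a)).
- now rewrite !app_nth1 by easy.
- rewrite !app_nth2 by lia; destruct (e - length a)%nat eqn:E; [lia|easy].
Qed.

Lemma nth_app_cons_eq (a b : list nat) (i : nat) : nth (length a) (a ++ i :: b) 0%nat = i.
Proof. now rewrite app_nth2, Nat.sub_diag by lia. Qed.

(** This explains the radius t' of [midpoint_families]: it is the l_l-combination of the
    half-distance t/2 with a disjoint perturbation of norm K sigma t. *)
Lemma rpow_midpoint_scale (t sigma K l : R) :
  1 <= l -> 0 < t -> 0 < sigma -> 0 < K ->
  rpow (t / 2) l + rpow (K * sigma * t) l =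
  rpow (t / 2 * rpow (1 + rpow (2 * K * sigma) l) (1 / l)) l.
Proof.
intros Hl Ht Hs HK; assert (HKs : 0 < K * sigma) by now apply Rmult_lt_0_compat.
pose proof (rpow_ge0 (2 * K * sigma) l).
rewrite (rpow_mult (t / 2)) by (lra || apply rpow_ge0).
rewrite rpow_inv_rpow by lra.
replace (K * sigma * t) with (t / 2 * (2 * K * sigma)) by field.
rewrite (rpow_mult (t / 2)) by lra; ring.
Qed.

Lemma ns_half (s : R) (u x y : rseq) :
  1 <= s -> finsupp x -> finsupp y ->
  (forall i, Rabs (u i) <= Rabs ((x i - y i) / 2)) -> ns s u <= / 2 * ns s (rsub x y).
Proof.
intros Hs Hx Hy H; apply ns_scal_le; [easy|lra|now apply finsupp_rsub|].
intros i; apply Rle_trans with (1 := H i); unfold rsub, Rdiv.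
rewrite Rabs_mult, (Rabs_pos_eq (/ 2)) by lra; lra.
Qed.

Section SpreadVector.

Variables (k : nat) (c : R).
Hypothesis Hk : (1 <= k)%nat.
Hypothesis Hc : 0 < c.

(* [c] times the sum of the unit vectors at the [k] positions [k * m_i + i], which
   are automatically distinct. *)
Definition spread (m : list nat) : rseq :=
  fun i => if Nat.eq_dec (i / k) (nth (i mod k) m 0%nat) then c else 0.

Definition spread_support (m : list nat) : list nat :=
  map (fun i => (k * nth i m 0 + i)%nat) (seq 0 k).

Lemma spread_out (m : list nat) (i : nat) : ~ In i (spread_support m) -> spread m i = 0.
Proof.
intros H; unfold spread; destruct (Nat.eq_dec (i / k) (nth (i mod k) m 0%nat)) as [E|]; [|easy].
exfalso; apply H, in_map_iff; exists (i mod k)%nat; split.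
- rewrite <- E; symmetry; apply Nat.div_mod_eq.
- apply in_seq; pose proof (Nat.mod_upper_bound i k); lia.
Qed.

Lemma spread_at (m m' : list nat) (i : nat) : (i < k)%nat ->
  spread m' (k * nth i m 0 + i)%nat = if Nat.eq_dec (nth i m 0%nat) (nth i m' 0%nat) then c else 0.
Proof.
intros Hi; unfold spread.
replace ((k * nth i m 0 + i) / k)%nat with (nth i m 0%nat).
- replace ((k * nth i m 0 + i) mod k)%nat with i; [easy|].
  apply Nat.mod_unique with (nth i m 0%nat); lia.
- apply Nat.div_unique with i; lia.
Qed.

Lemma finsupp_spread (m : list nat) : finsupp (spread m).
Proof. apply (finsupp_of_list (spread_support m)), spread_out. Qed.

Lemma ns_spread (s : R) (m : list nat) : 1 <= s -> ns s (spread m) <= root k s * c.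
Proof.
intros Hs; replace k with (length (spread_support m)) at 1
  by (unfold spread_support; now rewrite length_map, length_seq).
apply ns_le_support; [easy|lra|apply spread_out|].
intros i; unfold spread; destruct (Nat.eq_dec _ _); rewrite ?Rabs_R0, ?Rabs_pos_eq; lra.
Qed.

Lemma ns_spread_step (s : R) (a b : list nat) (i j : nat) : 1 <= s ->
  ns s (rsub (spread (a ++ i :: b)) (spread (a ++ j :: b))) <= 2 * c.
Proof.
intros Hs; apply Rle_trans with (root 2 s * c).
- apply (ns_le_support s c [(k * i + length a)%nat; (k * j + length a)%nat]); [easy|lra| |].
  + intros n Hn; unfold rsub, spread.
    destruct (Nat.eq_dec (n mod k) (length a)) as [E|E].
    * rewrite E, !nth_app_cons_eq.
      assert (Hdm := Nat.div_mod_eq n k); rewrite E in Hdm.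
      destruct (Nat.eq_dec (n / k) i) as [E1|], (Nat.eq_dec (n / k) j) as [E2|]; try ring;
        exfalso; apply Hn; simpl; subst; auto.
    * rewrite (nth_app_cons_ne a b i j) by easy; destruct (Nat.eq_dec _ _); ring.
  + intros n; unfold rsub, spread; repeat destruct (Nat.eq_dec _ _);
      unfold Rabs; destruct (Rcase_abs _); lra.
- apply Rmult_le_compat_r; [lra|now apply root_2_le].
Qed.

(** Residues modulo [k] tell the entries apart, so a position of [m] could meet one of m' only at
    the same index, where the entries differ. All [k] coordinates of size [c] survive. *)
Lemma ns_spread_sep (s : R) (m m' : list nat) : 1 <= s ->
  (forall i, (i < k)%nat -> nth i m 0%nat <> nth i m' 0%nat) ->
  root k s * c / 4 <= ns s (rsub (spread m) (spread m')).
Proof.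
intros Hs Hd; replace k with (length (spread_support m)) at 1
  by (unfold spread_support; now rewrite length_map, length_seq).
apply ns_ge_support; [easy|easy|apply finsupp_rsub; apply finsupp_spread| |].
- apply NoDup_map_NoDup_ForallPairs; [|apply seq_NoDup].
  intros i j Hi Hj E; apply in_seq in Hi, Hj.
  assert (Ei : ((k * nth i m 0 + i) mod k = i)%nat)
    by (symmetry; apply Nat.mod_unique with (nth i m 0%nat); lia).
  assert (Ej : ((k * nth j m 0 + j) mod k = j)%nat)
    by (symmetry; apply Nat.mod_unique with (nth j m 0%nat); lia).
  rewrite <- Ei, <- Ej; now f_equal.
- intros n Hn; apply in_map_iff in Hn; destruct Hn as (i & <- & Hi); apply in_seq in Hi.
  unfold rsub; rewrite !spread_at by lia.
  destruct (Nat.eq_dec (nth i m 0%nat) (nth i m 0%nat)) as [_|]; [|easy].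
  destruct (Nat.eq_dec (nth i m 0%nat) (nth i m' 0%nat)) as [E|_]; [now apply Hd in E; lia|].
  rewrite Rminus_0_r, Rabs_pos_eq; lra.
Qed.

End SpreadVector.

Lemma sum_dist_ge_row (p q : R) (x y : nat -> rseq) (n : nat) :
  1 <= q -> finsupp2 x -> finsupp2 y -> ns p (rsub (x n) (y n)) <= sum_dist p q x y.
Proof.
intros Hq Hx Hy.
pose proof (ns_abs q _ n Hq (finsupp_row_norms p x y Hx Hy)) as H; cbv beta in H.
rewrite Rabs_pos_eq in H by apply ns_ge0; exact H.
Qed.

Lemma sum_dist_le_row (p q c : R) (x y : nat -> rseq) (n0 : nat) :
  1 <= q -> (forall n i, n <> n0 -> x n i = y n i) ->
  ns p (rsub (x n0) (y n0)) <= c -> sum_dist p q x y <= c.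
Proof.
intros Hq H Hc; assert (H0 := ns_ge0 p (rsub (x n0) (y n0))).
assert (Hz : forall n, n <> n0 -> ns p (rsub (x n) (y n)) = 0).
{ intros n Hn; apply ns_eq0; intros i; unfold rsub; rewrite H by easy; ring. }
rewrite <- (Rmult_1_l c), <- (root_1 q).
apply (ns_le_support q c [n0]); [easy|lra| |].
- intros n Hn; apply Hz; intros ->; apply Hn; simpl; auto.
- intros n; rewrite Rabs_pos_eq by apply ns_ge0.
  destruct (Nat.eq_dec n n0) as [->|Hn]; [easy|rewrite Hz by easy; lra].
Qed.

Lemma sum_dist_refl (p q : R) (x : nat -> rseq) : sum_dist p q x x = 0.
Proof. apply ns_eq0; intros n; apply ns_eq0; intros i; unfold rsub; ring. Qed.

Lemma finsupp2_zero : finsupp2 (fun _ _ => 0).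
Proof. now exists 0%nat. Qed.

(* Midpoints are perturbed by a spread vector in one far row: the outer norm adds
   it as in l_l, the inner one sees [k] coordinates as in l_s. *)
Lemma midpoint_families_outer (s l : R) (k : nat) :
  1 <= s -> s < l -> (1 <= k)%nat -> midpoint_families (sum_dist s l) finsupp2 s l k.
Proof.
intros Hs Hsl Hk; assert (Hl : 1 <= l) by lra.
exists (fun t x y => finsupp2 x /\ finsupp2 y /\ sum_dist s l x y <= t).
assert (HK := root_ge1 k s Hs Hk); split; [|split].
- exists (fun _ _ => 0); intros t Ht; rewrite sum_dist_refl.
  repeat split; [apply finsupp2_zero..|lra].
- intros t x y (Hx & Hy & Hxy); repeat split; try easy.
  assert (0 <= sum_dist s l x y) by apply ns_ge0; nra.
- intros t sigma x y Ht Hsg (Hx & Hy & Hxy); set (c := sigma * t).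
  assert (Hc : 0 < c) by now apply Rmult_lt_0_compat.
  destruct Hx as [N1 HN1] eqn:E1; destruct Hy as [N2 HN2] eqn:E2; clear E1 E2.
  set (N := max N1 N2).
  set (W := fun m n i => if Nat.eq_dec n N then spread k c m i else (x n i + y n i) / 2).
  assert (WN : forall m, W m N = spread k c m).
  { intros m; apply functional_extensionality; intros i; unfold W.
    now destruct (Nat.eq_dec N N). }
  assert (HfW : forall m, finsupp2 (W m)).
  { intros m; destruct (finsupp_spread k c Hk m) as [M HM].
    exists (max (S N) M); intros n i Hni; unfold W; destruct (Nat.eq_dec n N) as [->|].
    - apply HM; lia.
    - rewrite HN1, HN2 by lia; field. }
  (* Stated for a general [z] to serve both endpoints, from which the midpoint differs by plus or
     minus (x - y)/2. *)
  assert (Hmid : forall m z, (forall n i, (N <= n)%nat -> z n i = 0) -> finsupp2 z ->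
     (forall n i, (x n i + y n i) / 2 - z n i = (x n i - y n i) / 2 \/
                  (x n i + y n i) / 2 - z n i = - ((x n i - y n i) / 2)) ->
     sum_dist s l (W m) z <=
       t / 2 * rpow (1 + rpow (2 * root k s * sigma) l) (1 / l)).
  { intros m z Hz Hfz Hxyz.
    assert (Hge : 0 <= t / 2 * rpow (1 + rpow (2 * root k s * sigma) l) (1 / l))
      by (apply Rmult_le_pos; [lra|apply rpow_ge0]).
    apply (rpow_le_inv _ _ l); [lra|easy|].
    rewrite <- rpow_midpoint_scale by lra.
    set (v1 := fun n => / 2 * ns s (rsub (x n) (y n))).
    set (v2 := fun n => if Nat.eq_dec n N then ns s (spread k c m) else 0).
    assert (Hfxy : finsupp (fun n => ns s (rsub (x n) (y n))))
      by (apply finsupp_row_norms; [now exists N1|now exists N2]).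
    assert (Hv1 : ns l v1 <= / 2 * sum_dist s l x y).
    { apply ns_scal_le; try easy; try lra; intros n; unfold v1.
      rewrite Rabs_mult, (Rabs_pos_eq (/ 2)); lra. }
    assert (Hv2 : ns l v2 <= root k s * sigma * t).
    { apply Rle_trans with (root 1 l * ns s (spread k c m)).
      - apply (ns_le_support l _ [N]); [easy|apply ns_ge0| |].
        + intros n Hn; unfold v2; destruct (Nat.eq_dec n N) as [->|]; [|easy].
          exfalso; apply Hn; simpl; auto.
        + intros n; unfold v2; pose proof (ns_ge0 s (spread k c m)).
          destruct (Nat.eq_dec n N); [rewrite Rabs_pos_eq; lra|rewrite Rabs_R0; lra].
      - rewrite root_1, Rmult_1_l, Rmult_assoc; now apply ns_spread. }
    apply Rle_trans with (rpow (ns l v1) l + rpow (ns l v2) l).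
    - apply ns_disjoint; [easy| | |apply finsupp_row_norms; auto|].
      + destruct Hfxy as [N3 HN3]; exists N3; intros n Hn; unfold v1; rewrite HN3; lra || easy.
      + exists (S N); intros n Hn; unfold v2; destruct (Nat.eq_dec n N); [lia|easy].
      + intros n; destruct (Nat.eq_dec n N) as [->|Hn].
        * right; unfold v2; destruct (Nat.eq_dec N N) as [_|]; [|easy].
          rewrite WN, !Rabs_pos_eq by apply ns_ge0; apply ns_mono; [easy|now apply finsupp_spread|].
          intros i; unfold rsub; rewrite Hz, Rminus_0_r by lia; lra.
        * left; unfold v1; pose proof (ns_ge0 s (rsub (x n) (y n))).
          rewrite !Rabs_pos_eq by (lra || apply ns_ge0).
          apply ns_half; [easy|exists N1; auto|exists N2; auto|].
          intros i; unfold rsub, W; destruct (Nat.eq_dec n N); [easy|].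
          destruct (Hxyz n i) as [-> | ->]; rewrite ?Rabs_Ropp; lra.
    - apply Rplus_le_compat; apply rpow_le; lra. }
  exists W; repeat split; try apply HfW; try (now exists N1); try (now exists N2).
  + apply Hmid; [intros n i Hn; apply HN1; lia|now exists N1|].
    intros n i; right; field.
  + apply Hmid; [intros n i Hn; apply HN2; lia|now exists N2|].
    intros n i; left; field.
  + intros a i j b _; apply sum_dist_le_row with N; [easy| |].
    * intros n e Hn; unfold W; now destruct (Nat.eq_dec n N).
    * rewrite !WN, Rmult_assoc; now apply ns_spread_step.
  + intros m m' _ _ Hd.
    apply Rle_trans with (2 := sum_dist_ge_row s l (W m) (W m') N Hl (HfW m) (HfW m')).
    rewrite !WN, Rmult_assoc; now apply ns_spread_sep.
Qed.

(* Midpoints are perturbed by one far unit vector in each of the first [k] rows; the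
   auxiliary metric is the maximum over these rows of the inner norms. *)
Lemma midpoint_families_inner (s l : R) (k : nat) :
  1 <= s -> s < l -> (1 <= k)%nat -> midpoint_families (sum_dist l s) finsupp2 s l k.
Proof.
intros Hs Hsl Hk; assert (Hl : 1 <= l) by lra.
(* In the norm of the sum, perturbing [k] rows would only combine with the half-distance through the
   outer T^s. Row by row, the upper l-estimate of the inner T^l applies. *)
exists (fun t x y => finsupp2 x /\ finsupp2 y /\
  (forall n i, (k <= n)%nat -> x n i = y n i) /\ (forall n, ns l (rsub (x n) (y n)) <= t)).
assert (HK := root_ge1 k s Hs Hk).
assert (Hz : forall x y : nat -> rseq, (forall n i, (k <= n)%nat -> x n i = y n i) ->
  forall n, (k <= n)%nat -> ns l (rsub (x n) (y n)) = 0).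
{ intros x y H n Hn; apply ns_eq0; intros i; unfold rsub; rewrite H by easy; ring. }
split; [|split].
- exists (fun _ _ => 0); intros t Ht; repeat split; try apply finsupp2_zero.
  intros n; rewrite ns_eq0; [lra|]; intros i; unfold rsub; ring.
- intros t x y (Hx & Hy & Hxy & Ht); repeat split; try easy.
  assert (0 <= t) by (apply Rle_trans with (2 := Ht 0%nat), ns_ge0).
  replace k with (length (seq 0 k)) at 1 by apply length_seq.
  apply ns_le_support; [easy|easy| |].
  + intros n Hn; apply Hz; [easy|]; rewrite in_seq in Hn; lia.
  + intros n; rewrite Rabs_pos_eq by apply ns_ge0; apply Ht.
- intros t sigma x y Ht Hsg (Hx & Hy & Hxy & Hn); set (c := sigma * t).
  assert (Hc : 0 < c) by now apply Rmult_lt_0_compat.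
  destruct Hx as [N1 HN1] eqn:E1; destruct Hy as [N2 HN2] eqn:E2; clear E1 E2.
  set (N := max N1 N2).
  set (e := fun j i => if Nat.eq_dec i (N + j) then c else 0).
  set (W := fun m n i => if lt_dec n k then (x n i + y n i) / 2 + e (nth n m 0%nat) i else x n i).
  assert (He : forall j, ns l (e j) <= c).
  { intros j; rewrite <- (Rmult_1_l c), <- (root_1 l).
    apply (ns_le_support l c [(N + j)%nat]); [easy|lra| |].
    - intros i Hi; unfold e; destruct (Nat.eq_dec i (N + j)) as [->|]; [|easy].
      exfalso; apply Hi; simpl; auto.
    - intros i; unfold e; destruct (Nat.eq_dec i (N + j)); rewrite ?Rabs_R0, ?Rabs_pos_eq; lra. }
  assert (Hfe : forall j, finsupp (e j)).
  { intros j; exists (S (N + j)); intros i Hi; unfold e.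
    destruct (Nat.eq_dec i (N + j)); [lia|easy]. }
  assert (HfW : forall m, finsupp2 (W m)).
  { intros m; exists (S (max k N + list_max m)); intros n i Hni; unfold W, e.
    pose proof (nth_le_list_max m n).
    destruct (lt_dec n k); [|apply HN1; lia].
    destruct (Nat.eq_dec i (N + nth n m 0%nat)); [lia|].
    rewrite HN1, HN2 by lia; field. }
  assert (Hmid : forall m z, (forall n i, (N <= i)%nat -> z n i = 0) -> finsupp2 z ->
     (forall n i, (k <= n)%nat -> x n i = z n i) ->
     (forall n i, (x n i + y n i) / 2 - z n i = (x n i - y n i) / 2 \/
                  (x n i + y n i) / 2 - z n i = - ((x n i - y n i) / 2)) ->
     forall n, ns l (rsub (W m n) (z n)) <=
       t / 2 * rpow (1 + rpow (2 * root k s * sigma) l) (1 / l)).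
  { intros m z Hz0 Hfz Hxz Hxyz n.
    assert (Hge : 0 <= t / 2 * rpow (1 + rpow (2 * root k s * sigma) l) (1 / l))
      by (apply Rmult_le_pos; [lra|apply rpow_ge0]).
    destruct (lt_dec n k) as [Hnk|Hnk].
    - apply (rpow_le_inv _ _ l); [lra|easy|].
      rewrite <- rpow_midpoint_scale by lra.
      set (v := fun i => (x n i - y n i) / 2).
      assert (Hfx : finsupp (x n)) by (exists N1; auto).
      assert (Hfy : finsupp (y n)) by (exists N2; auto).
      assert (Hv : ns l v <= / 2 * ns l (rsub (x n) (y n)))
        by (apply ns_half; try easy; intros i; unfold v; lra).
      specialize (Hn n).
      apply Rle_trans with (rpow (ns l v) l + rpow (ns l (e (nth n m 0%nat))) l).
      + apply ns_disjoint; [easy| |apply Hfe|apply finsupp_rsub; now apply finsupp2_row|].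
        * exists N; intros i Hi; unfold v; rewrite HN1, HN2 by lia; field.
        * intros i; unfold rsub, W; destruct (lt_dec n k) as [_|]; [|easy].
          destruct (le_lt_dec N i).
          -- right; rewrite HN1, HN2, Hz0 by lia; apply Req_le; f_equal; field.
          -- left; unfold e; destruct (Nat.eq_dec i (N + nth n m 0%nat)); [lia|].
             rewrite Rplus_0_r; unfold v.
             destruct (Hxyz n i) as [-> | ->]; rewrite ?Rabs_Ropp; lra.
      + apply Rplus_le_compat; apply rpow_le; try lra.
        (* A row is perturbed only by sigma t, within the allowance root k s * sigma * t since root
           k s >= 1. *)
        apply Rle_trans with (1 := He _); rewrite Rmult_assoc; fold c; nra.
    - rewrite ns_eq0; [easy|]; intros i; unfold rsub, W; destruct (lt_dec n k); [easy|].
      rewrite Hxz by lia; ring. }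
  assert (Wrow : forall m n i, (k <= n)%nat -> W m n i = x n i).
  { intros m n i Hkn; unfold W; destruct (lt_dec n k); [lia|easy]. }
  exists W; repeat split; try apply HfW; try (now exists N1); try (now exists N2).
  + intros n i; apply Wrow.
  + apply Hmid; [intros n i Hi; apply HN1; lia|now exists N1|easy|].
    intros n i; right; field.
  + intros n i Hkn; rewrite Wrow by easy; now apply Hxy.
  + apply Hmid; [intros n i Hi; apply HN2; lia|now exists N2|easy|].
    intros n i; left; field.
  + intros a i j b _; apply sum_dist_le_row with (length a); [easy| |].
    * intros n o Hno; unfold W; destruct (lt_dec n k); [|easy].
      now rewrite (nth_app_cons_ne a b i j) by easy.
    * apply Rle_trans with (root 2 l * c);
        [|rewrite Rmult_assoc; fold c; apply Rmult_le_compat_r; [lra|now apply root_2_le]].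
      apply (ns_le_support l c [(N + i)%nat; (N + j)%nat]); [easy|lra| |].
      -- intros o Ho; unfold rsub, W; destruct (lt_dec (length a) k); [|ring].
         rewrite !nth_app_cons_eq; unfold e.
         destruct (Nat.eq_dec o (N + i)) as [->|]; [exfalso; apply Ho; simpl; auto|].
         destruct (Nat.eq_dec o (N + j)) as [->|]; [exfalso; apply Ho; simpl; auto|]; ring.
      -- intros o; unfold rsub, W; destruct (lt_dec (length a) k);
           [|rewrite Rminus_diag, Rabs_R0; lra].
         rewrite !nth_app_cons_eq; unfold e.
         destruct (Nat.eq_dec o (N + i)), (Nat.eq_dec o (N + j));
           unfold Rabs; destruct (Rcase_abs _); lra.
  + intros m m' _ _ Hd; rewrite Rmult_assoc; fold c.
    replace k with (length (seq 0 k)) at 1 by apply length_seq.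
    apply ns_ge_support; [easy|easy|now apply finsupp_row_norms|apply seq_NoDup|].
    intros n Hnk; apply in_seq in Hnk; specialize (Hd n ltac:(lia)).
    rewrite Rabs_pos_eq by apply ns_ge0.
    assert (Hfr : finsupp (rsub (W m n) (W m' n)))
      by (apply finsupp_rsub; now apply finsupp2_row).
    apply Rle_trans with (2 := ns_abs l _ (N + nth n m 0%nat) Hl Hfr).
    unfold rsub, W; destruct (lt_dec n k); [|lia]; unfold e.
    destruct (Nat.eq_dec (N + nth n m 0%nat) (N + nth n m 0%nat)) as [_|]; [|easy].
    destruct (Nat.eq_dec (N + nth n m 0%nat) (N + nth n m' 0%nat)); [lia|].
    set (w := (x n (N + nth n m 0%nat)%nat + y n (N + nth n m 0%nat)%nat) / 2).
    replace (w + c - (w + 0)) with c by ring; rewrite Rabs_pos_eq; lra.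
Qed.

Theorem theoremA1 (p q : R) (hp : 1 <= p) (hq : 1 <= q) (hpq : p <> q) :
  ~ exists f : (nat -> rseq) -> rseq * rseq,
      coarse_lipschitz_embedding (inSumTpTq p q) (SumTpTq_dist p q)
                                 (inTpTq p q) (TpTq_dist p q) f.
Proof.
intros (f & Hin & L & HL & Hup & Hlo).
assert (Hd0 : forall x y, 0 <= sum_dist p q x y) by (intros; apply ns_ge0).
assert (HX : forall x, finsupp2 x -> inSumTpTq p q x)
  by (intros; now apply inSumTpTq_finsupp2).
assert (Hup' : forall x y, finsupp2 x -> finsupp2 y ->
  TpTq_dist p q (f x) (f y) <= L * sum_dist p q x y + L).
{ intros x y Hx Hy; apply Hup; auto.
  rewrite SumTpTq_dist_finsupp2 by easy; lra. }
assert (Hlo' : forall x y, finsupp2 x -> finsupp2 y ->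
  sum_dist p q x y / L - L <= TpTq_dist p q (f x) (f y)).
{ intros x y Hx Hy; apply Hlo; auto.
  rewrite SumTpTq_dist_finsupp2 by easy; lra. }
assert (Hf : forall x, finsupp2 x -> inTr p (fst (f x)) /\ inTr q (snd (f x)))
  by (intros x Hx; apply Hin; auto).
(* The smaller exponent always plays [s]: for p > q the two components of [f] exchange roles and the
   T^l direction is the inner one. *)
destruct (Rtotal_order p q) as [Hlt|[Heq|Hgt]]; [|easy|].
- apply (not_coarse_lipschitz_pair p q L _ (sum_dist p q) finsupp2
    (fun x => fst (f x)) (fun x => snd (f x))); try easy.
  intros k Hk; now apply midpoint_families_outer.
- apply (not_coarse_lipschitz_pair q p L _ (sum_dist p q) finsupp2
    (fun x => snd (f x)) (fun x => fst (f x))); try easy.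
  + intros x Hx; split; now apply Hf.
  + intros x y Hx Hy; rewrite Rplus_comm; now apply Hup'.
  + intros x y Hx Hy; rewrite Rplus_comm; now apply Hlo'.
  + intros k Hk; now apply midpoint_families_inner.
Qed.
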